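(* If $G$ is a graph with $\mathrm{mad}(G)<20/7$, then $\chi_o(G)\le 5$. This includes all planar graphs of girth at least $7$; that is, every planar graph $G$ of girth at least $7$ satisfies $\mathrm{mad}(G)<20/7$, and hence $\chi_o(G)\le 5$.
   Context: All graphs are finite, simple and have at least one vertex. A proper coloring of a graph $G$ is called odd if every non-isolated vertex $v$ has some color that appears an odd number of times on its (open) neighborhood $N(v)$. The smallest number of colors in an odd coloring of $G$ is denoted $\chi_o(G)$. The maximum average degree of $G$ is $\mathrm{mad}(G):=\max_{H\subseteq G}2|E(H)|/|V(H)|$, the maximum being over all non-empty subgraphs $H$ of $G$. The girth of a graph is the length of a shortest cycle; the girth of an acyclic graph is infinite. *)

(* Defs.v *)
From HB Require Import structures.
From mathcomp Require Import all_boot all_order all_algebra.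
From mathcomp Require Import all_classical all_reals all_analysis.

Set Implicit Arguments.
Unset Strict Implicit.
Unset Printing Implicit Defensive.

Import Order.TTheory GRing.Theory Num.Theory.
Import numFieldNormedType.Exports.

Local Open Scope classical_set_scope.
Local Open Scope ring_scope.

Record sgraph := SGraph {
  vertex :> finType;
  adj : rel vertex;
  adj_sym : symmetric adj;
  adj_irrefl : irreflexive adj;
  vertex_gt0 : (0 < #|vertex|)%N }.

Section Graph.
Variable G : sgraph.

Definition nbhd (v : G) : {set G} := finset (adj v).

Definition edges : {set {set G}} :=
  [set e : {set G} | [exists x, exists y, adj x y && (e == [set x; y]%SET)]]%SET.

Definition odd_coloring (k : nat) (c : {ffun G -> 'I_k}) : bool :=
  [forall x, forall y, adj x y ==> (c x != c y)] &&
  [forall v, (nbhd v != finset.set0) ==>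
    [exists i, odd #|[set u in nbhd v | c u == i]%SET|]].

Definition odd_colorable (k : nat) : bool :=
  [exists c : {ffun G -> 'I_k}, odd_coloring c].

Lemma odd_colorable_card : exists k, odd_colorable k.
Proof.
exists #|G|; apply/existsP; exists [ffun x => enum_rank x].
apply/andP; split.
  apply/forallP => x; apply/forallP => y; apply/implyP => xy.
  rewrite !ffunE (inj_eq enum_rank_inj); apply: contraTneq xy => ->.
  by rewrite adj_irrefl.
apply/forallP => v; apply/implyP => /finset.set0Pn[u uv].
apply/existsP; exists (enum_rank u).
rewrite (_ : finset _ = [set u]%SET) ?cards1//.
apply/setP => w; rewrite !inE ffunE (inj_eq enum_rank_inj).
by case: eqVneq => [->|]; rewrite ?andbF// andbT; move: uv; rewrite inE.
Qed.

Definition chi_o : nat := ex_minn odd_colorable_card.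

(* A subgraph is encoded as the pair (vertex set, edge set); it need not be
   induced. *)
Definition subgraph (H : {set G} * {set {set G}}) : bool :=
  (H.2 \subset edges) && [forall e in H.2, e \subset H.1].

(* The ratios are nonnegative and G itself is a nonempty subgraph, so the
   default value 0 does not affect the maximum. *)
Definition mad : rat :=
  \big[Num.max/0]_(H : {set G} * {set {set G}}
                     | (H.1 != finset.set0) && subgraph H)
    ((2 * #|H.2|)%N%:R / #|H.1|%:R).

Definition graph_cycle (p : seq G) : Prop := (2 < size p)%N /\ ucycle (@adj G) p.

(* The infimum of the empty set is +oo, the girth of an acyclic graph. *)
Definition girth (R : realType) : \bar R :=
  ereal_inf [set ((size p)%:R : R)%:E | p in graph_cycle].

(* G has a crossing-free drawing in the plane: vertices are distinct points,
   every edge is a simple arc joining its two ends, and the interior of an edge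
   contains no vertex and no point of any other edge. *)
Definition planar (R : realType) : Prop :=
  exists (pos : G -> R * R) (arc : {set G} -> R -> R * R),
    [/\ injective pos,
        forall e, e \in edges ->
          [/\ {within `[0, 1], continuous (arc e)},
              {in `[0, 1] &, injective (arc e)} &
              [set arc e 0; arc e 1] = pos @` [set` e]],
        forall e, e \in edges -> arc e @` `]0, 1[ `&` range pos = set0 &
        forall e f, e \in edges -> f \in edges -> e != f ->
          arc e @` `]0, 1[ `&` arc f @` `[0, 1] = set0].

End Graph.

(* Main.v *)
Require Import Defs.
From mathcomp Require Import all_boot all_order all_algebra.
From mathcomp Require Import zify lra.
From mathcomp Require boolp.

(** The coloring bound is a discharging argument.  Induct on vertex sets [A]
    and color the graph induced by [A].  A vertex of odd degree always sees
    some color an odd number of times, so only even vertices constrain, and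
    such a vertex constrains only the last of its neighbors to be colored, by
    forbidding one color.  Hence a vertex can be colored as soon as the number
    of its colored neighbors plus the number of even neighbors for which it is
    the last one is at most 4 ([extend_vertex]); in particular a 2-vertex can
    always be colored.  So one may uncolor a vertex together with its
    2-neighbors and color the vertex first, or do the same with two adjacent
    4-vertices; the configurations in which this works cannot occur when [A]
    is a smallest set without an odd 5-coloring ([star_reducible],
    [double_star_reducible]).  Give each vertex the charge [7 * deg] and let
    every neighbor of a 2-vertex send it 3, and every vertex of degree at
    least 4 send 1 to each neighbor that is a 3-vertex with a 2-neighbor or a
    4-vertex with three 2-neighbors.  In such a smallest set every vertex ends
    with at least 20 ([final_charge_ge20]), against an average degree below
    20/7.

    For a planar graph of girth at least [k], a subgraph with [n] vertices and
    [m] edges satisfies [k * (m + 1) <= 2 * m + k * n], the usual consequence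
    of Euler's formula; for [k = 7] this gives [m < 10 * n / 7].  As the edges
    are arbitrary continuous arcs, which have no evident two sides, faces are
    defined in a finite model of the drawing instead of the plane.  By
    compactness distinct arcs are a positive distance apart outside small
    squares around the vertices.  After rounding to a fine enough grid, the
    square around each vertex, together with an initial part of the rounded
    arcs that leave it, becomes a connected set of grid points; these sets are
    disjoint and adjacent vertices get adjacent sets ([planar_grid_minor]).

    In the grid the topology is elementary.  Call two unit squares equivalent
    when they can be joined without crossing a grid edge that lies inside one
    of the sets or that was selected to represent an edge of the graph.  The
    classes play the part of faces.  The boundary of a face is an even edge
    set ([face_boundary_even]), because around a grid point every square is
    counted twice.  Conversely every even edge set is a sum of face boundaries
    ([face_winding]): trace it by closed grid walks and give each square the
    parity of the crossings with a horizontal ray, a parity which is constant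
    on faces and changes exactly across the edges of the set.  Since the even
    sets over F_2 have dimension at least [m - n + 1], at least that many
    faces have a nonempty boundary; each such boundary contains a cycle and so
    has at least [k] edges, and an edge lies on at most two faces
    ([two_sided_bound], [grid_minor_bound]). *)

Set Implicit Arguments.
Unset Strict Implicit.
Unset Printing Implicit Defensive.

Import Order.TTheory GRing.Theory Num.Theory.

(** * Extending odd colorings *)
Section Coloring.
Variable G : sgraph.
Implicit Types (A B S : {set G}) (c : G -> 'I_5) (v w x y : G).

Definition nbrs A x : {set G} := [set y in A | adj x y].
Definition deg A x := #|nbrs A x|.

Definition odd_at A c w : bool :=
  [exists i, odd #|[set u in nbrs A w | c u == i]|].

(** Oddness is asked of a vertex only once all its neighbors in [A] are in the
    colored set [B], whether or not the vertex itself is in [B]: this is the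
    invariant preserved when the vertices are colored one at a time. *)
Definition partial_odd A B c : Prop :=
  (forall x y, x \in B -> y \in B -> adj x y -> c x != c y) /\
  (forall w, w \in A -> nbrs A w != set0 -> nbrs A w \subset B -> odd_at A c w).

Definition colorable A := exists c, partial_odd A A c.

Lemma in_nbrs A x y : (y \in nbrs A x) = (y \in A) && adj x y.
Proof. by rewrite inE. Qed.

(** The color classes partition [S], so they cannot all have even size. *)
Lemma odd_color_class (S : {set G}) c :
  odd #|S| -> exists i, odd #|[set u in S | c u == i]|.
Proof.
move=> oS; apply/existsP; apply: contraTT oS => /existsPn noS.
rewrite -sum1_card (partition_big c xpredT) //=.
rewrite (eq_bigr (fun i => #|[set u in S | c u == i]|)); last first.
  by move=> i _; rewrite -sum1_card; apply: eq_bigl => u; rewrite inE.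
apply: (big_ind (fun n => ~~ odd n)) => [//|m n|i _]; last exact: noS.
by rewrite oddD => /negbTE-> /negbTE->.
Qed.

Lemma odd_deg_odd_at A c w : odd (deg A w) -> odd_at A c w.
Proof. by move=> /(odd_color_class c)/existsP. Qed.

(** A vertex [w] of even degree that lacks only the color of [x] sees an odd
    number of other neighbors, hence some color an odd number of times; it is
    enough that [x] avoids this one color. *)
Lemma extend_vertex A B c x :
  x \notin B -> partial_odd A B c ->
  #|nbrs B x| + #|[set w in nbrs A x | ~~ odd (deg A w) & nbrs A w \subset x |: B]| < 5 ->
  exists c', partial_odd A (x |: B) c'.
Proof.
move=> xB [cB oB]; set W := [set w in _ | _] => lt5.
(* [f w] is a color seen an odd number of times by [w] when [x] is ignored. *)
pose O w := [set i | odd #|[set u in nbrs A w :\ x | c u == i]|].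
pose f w := odflt (c x) [pick i in O w].
pose bad := (c @: nbrs B x) :|: (f @: W).
have : #|bad| < #|'I_5|.
  rewrite card_ord (leq_ltn_trans _ lt5) //.
  rewrite (leq_trans (leq_card_setU _ _)) // leq_add // leq_imset_card //.
move=> lt_bad.
have [a abad] : exists a, a \notin bad.
  apply/existsP; apply: contraTT lt_bad; rewrite negb_exists => /forallP h.
  rewrite -leqNgt; apply: subset_leq_card; apply/subsetP => i _.
  by have := h i; rewrite negbK.
have acx y : y \in B -> adj x y -> c y != a.
  move=> yB xy; apply: contra abad => /eqP <-; rewrite inE imset_f //.
  by rewrite in_nbrs yB.
pose c' y := if y == x then a else c y.
have c'x : c' x = a by rewrite /c' eqxx.
have c'B y : y != x -> c' y = c y by rewrite /c' => /negbTE->.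
have neB y : y \in B -> y != x by apply: contraTneq => ->.
exists c'; split.
- move=> y z /setU1P[->|yB] /setU1P[->|zB].
  + by rewrite adj_irrefl.
  + by move=> xz; rewrite c'x (c'B z) ?neB // eq_sym acx.
  + by rewrite adj_sym => xy; rewrite c'x (c'B y) ?neB // acx.
  + by move=> yz; rewrite !c'B ?neB // cB.
move=> w wA nw0 sw.
case: (boolP (odd (deg A w))) => [/odd_deg_odd_at-> // | ev].
have [xw | xw] := boolP (x \in nbrs A w); last first.
  have swB : nbrs A w \subset B.
    apply/subsetP => y yw; have /setU1P[yx|//] := subsetP sw _ yw.
    by rewrite -yx yw in xw.
  have /existsP[i oi] := oB w wA nw0 swB.
  apply/existsP; exists i; congr (odd _): oi.
  apply: eq_card => y; rewrite !inE.
  case: (boolP (y \in A)) => // yA; case: (boolP (adj w y)) => //= wy.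
  by rewrite c'B // neB // (subsetP swB) // in_nbrs yA.
have wW : w \in W.
  by rewrite inE ev sw in_nbrs wA adj_sym; move: xw; rewrite in_nbrs => /andP[_ ->].
have oNx : odd #|nbrs A w :\ x|.
  by move: ev; rewrite /deg (cardsD1 x) xw oddD /= negbK.
have [i oi] := odd_color_class c oNx.
have fO : f w \in O w.
  by rewrite /f; case: pickP => //= /(_ i); rewrite inE oi.
have fa : f w != a.
  by apply: contra abad => /eqP <-; rewrite inE imset_f ?orbT.
apply/existsP; exists (f w); move: fO; rewrite inE; congr (odd _).
apply: eq_card => y; rewrite !inE.
case: (eqVneq y x) => [->|yx] /=; last by rewrite c'B.
by rewrite c'x eq_sym (negbTE fa) andbF.
Qed.

Lemma nbrsS A B x : A \subset B -> nbrs A x \subset nbrs B x.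
Proof.
move=> /subsetP AB; apply/subsetP => y; rewrite !in_nbrs => /andP[/AB-> ->] //.
Qed.

(** A 2-vertex has at most two colored neighbors and at most two neighbors
    waiting for its color: four forbidden colors out of five, whatever the
    order in which the 2-vertices are treated. *)
Lemma extend_2vertices A B c :
  B \subset A -> partial_odd A B c -> (forall x, x \in A :\: B -> deg A x <= 2) ->
  colorable A.
Proof.
move: {2}#|_| (leqnn #|A :\: B|) => n.
elim: n B c => [|n IH] B c.
  rewrite leqn0 cards_eq0 setD_eq0 => AB BA pc _.
  have eqAB : B = A by apply/eqP; rewrite eqEsubset AB BA.
  by exists c; rewrite eqAB in pc.
move=> le_n BA pc d2.
have [D0|[x xD]] := set_0Vmem (A :\: B).
  by apply: (IH B c) => //; rewrite D0 cards0.
have /setDP[xA xB] := xD.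
have [|c' pc'] := extend_vertex xB pc.
  apply: (@leq_ltn_trans (2 + 2)) => //; rewrite leq_add //.
    apply: leq_trans (d2 x xD); exact: subset_leq_card (nbrsS _ BA).
  apply: leq_trans (d2 x xD); apply: subset_leq_card.
  by apply/subsetP => w; rewrite inE => /andP[].
have sxB : x |: B \subset A by rewrite subUset sub1set xA.
apply: (IH _ _ _ sxB pc').
  rewrite -ltnS (leq_trans _ le_n) //.
  apply: proper_card; apply/properP; split; first by rewrite setDS ?subsetUr.
  by exists x; rewrite // !inE eqxx.
move=> y; rewrite !inE negb_or => /andP[/andP[_ yB] yA].
by apply: d2; rewrite inE yB.
Qed.

(** The vertices of [S] may already have all their neighbors colored, and the
    coloring of [A :\: S] says nothing about their oddness; the hypothesis on
    [S] rules this out for the even ones. *)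
Lemma partial_odd_setD A S c :
  partial_odd (A :\: S) (A :\: S) c ->
  (forall w, w \in S -> [|| odd (deg A w), nbrs A w :&: S != set0 | nbrs A w == set0]) ->
  partial_odd A (A :\: S) c.
Proof.
move=> [pc oc] hS; split=> // w wA w0 sw.
have [wS | wS] := boolP (w \in S).
  case/or3P: (hS w wS) => [/odd_deg_odd_at->//|/set0Pn[y]|]; last by rewrite (negbTE w0).
  by rewrite inE => /andP[/(subsetP sw)]; rewrite inE => /andP[/negbTE->].
have E : nbrs A w = nbrs (A :\: S) w.
  apply/setP => y; rewrite !in_nbrs inE; case: (boolP (y \in S)) => //= yS.
  apply/negbTE; apply/negP => yw.
  by have := subsetP sw y; rewrite in_nbrs inE yS yw => /(_ isT).
have := oc w; rewrite /odd_at -E; apply=> //; by rewrite inE wS.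
Qed.

Definition nbrs2 A v : {set G} := [set w in nbrs A v | deg A w == 2].
Definition nbrs_not2 A v : {set G} := [set w in nbrs A v | deg A w != 2].
Definition even_nbrs A v : {set G} := [set w in nbrs A v | ~~ odd (deg A w)].

(** Uncolor [v] and its 2-neighbors, then color [v] first.  Its colored
    neighbors are then among those of degree other than 2, and only even
    neighbors can be waiting for its color. *)
Lemma star_reducible A v :
  v \in A -> [|| odd (deg A v), nbrs2 A v != set0 | nbrs A v == set0] ->
  #|nbrs_not2 A v| + #|even_nbrs A v| <= 4 ->
  colorable (A :\: (v |: nbrs2 A v)) -> colorable A.
Proof.
move=> vA hv le4 [c pc]; set S := v |: _ in pc.
have pcA : partial_odd A (A :\: S) c.
  apply: partial_odd_setD => // w /setU1P[->|].
    case/or3P: hv => [->//|/set0Pn[y yT]|->]; last by rewrite !orbT.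
    apply/or3P/Or32/set0Pn; exists y; rewrite !inE in yT *.
    by rewrite yT orbT; case/andP: yT => ->.
  rewrite !inE => /andP[/andP[wA vw] _]; apply/or3P/Or32/set0Pn; exists v.
  by rewrite !inE vA eqxx adj_sym vw.
have vS : v \notin A :\: S by rewrite !inE eqxx.
have [|c' pc'] := extend_vertex vS pcA.
  rewrite ltnS (leq_trans _ le4) // leq_add //; apply: subset_leq_card.
    apply/subsetP => w; rewrite !inE negb_or => /andP[/andP[/andP[_ h] wA] vw].
    by move: h; rewrite wA vw.
  by apply/subsetP => w; rewrite !inE => /andP[-> /andP[->]].
apply: (extend_2vertices _ pc').
  by rewrite subUset sub1set vA subsetDl.
move=> w; rewrite !inE.
case: (eqVneq w v) => //= wv; case: (w \in A); rewrite ?andbF //= andbT.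
by case: (adj v w) => //=; case: eqP => // ->.
Qed.

(** Uncolor both centers and their 2-neighbors.  The center [v] is colored
    first and has no colored neighbor, since its neighbors are [w] and its
    2-neighbors.  When [w] is colored, [v] is its only colored neighbor and
    [v] is not waiting for [w], as its 2-neighbors are still uncolored. *)
Lemma double_star_reducible A v w :
  v \in A -> w \in A -> adj v w -> deg A v = 4 -> deg A w = 4 ->
  #|nbrs2 A v| = 3 -> #|nbrs2 A w| = 3 ->
  colorable (A :\: ([set v; w] :|: (nbrs2 A v :|: nbrs2 A w))) -> colorable A.
Proof.
move=> vA wA vw dv dw tv tw [c pc]; set S := _ :|: _ in pc.
have vwne : v != w by apply: contraTneq vw => ->; rewrite adj_irrefl.
have sub x y : x \in A -> y \in A -> adj x y -> deg A x = 4 -> deg A y = 4 ->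
    #|nbrs2 A x| = 3 -> nbrs A x \subset y |: nbrs2 A x.
  move=> xA yA xy dx dy tx.
  have ynT : y \notin nbrs2 A x by rewrite !inE dy andbF.
  have s : y |: nbrs2 A x \subset nbrs A x.
    by rewrite subUset sub1set in_nbrs yA xy; apply/subsetP => z; rewrite inE => /andP[].
  have /eqP <- // : y |: nbrs2 A x == nbrs A x.
  by rewrite eqEcard s cardsU1 ynT tx -/(deg A x) dx.
have sv := sub v w vA wA vw dv dw tv.
have sw := sub w v wA vA (etrans (adj_sym _ _) vw) dw dv tw.
have svS : nbrs A v \subset S.
  apply: (subset_trans sv); rewrite subUset sub1set !inE eqxx orbT /=.
  by apply/subsetP => x xT; rewrite !in_setU xT orbT.
have swS : nbrs A w \subset S.
  apply: (subset_trans sw); rewrite subUset sub1set !inE eqxx /=.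
  by apply/subsetP => x xT; rewrite !in_setU xT !orbT.
have pcA : partial_odd A (A :\: S) c.
  apply: partial_odd_setD => // x; rewrite inE => /orP[/set2P[]->|/setUP[]].
  - apply/or3P/Or32/set0Pn; exists w; rewrite !inE wA vw eqxx orbT //.
  - apply/or3P/Or32/set0Pn; exists v; rewrite !inE vA adj_sym vw eqxx //.
  - rewrite !inE => /andP[/andP[xA vx] _]; apply/or3P/Or32/set0Pn; exists v.
    by rewrite !inE vA eqxx adj_sym vx.
  - rewrite !inE => /andP[/andP[xA vx] _]; apply/or3P/Or32/set0Pn; exists w.
    by rewrite !inE wA eqxx adj_sym vx orbT.
have vS : v \notin A :\: S by rewrite !inE eqxx.
have [|c1 pc1] := extend_vertex vS pcA.
  rewrite (_ : nbrs _ v = set0) ?cards0 ?add0n.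
    rewrite ltnS -dv; apply: subset_leq_card.
    by apply/subsetP => x; rewrite inE => /andP[].
  apply/setP => x; rewrite in_nbrs inE in_set0; apply/negbTE/negP => /andP[/andP[xS xA] vx].
  by rewrite (subsetP svS) ?in_nbrs ?xA in xS.
have wS : w \notin v |: A :\: S by rewrite !inE eqxx eq_sym (negbTE vwne) ?orbT.
have [|c' pc'] := extend_vertex wS pc1.
  rewrite -[5]/((1 + 3).+1) ltnS leq_add //.
    rewrite -(cards1 v); apply: subset_leq_card.
    apply/subsetP => x; rewrite in_nbrs in_set1 in_setU1.
    move=> /andP[/orP[->//|/setDP[xA xS]] wx].
    by rewrite (subsetP swS) ?in_nbrs ?xA in xS.
  rewrite -ltnS -dw /deg.
  apply: proper_card; apply/properP; split.
    by apply/subsetP => x; rewrite inE => /andP[].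
  exists v; first by rewrite in_nbrs vA adj_sym.
  rewrite inE; apply/negP => /and3P[_ _ /subsetP sub1].
  have [x xT] : exists x, x \in nbrs2 A v by apply/set0Pn; rewrite -cards_eq0 tv.
  have := sub1 x; have xnb : x \in nbrs A v by move: xT; rewrite inE => /andP[].
  move=> /(_ xnb); have xA : x \in A by move: xnb; rewrite in_nbrs => /andP[].
  have xv : x != v by apply: contraTneq xnb => ->; rewrite in_nbrs adj_irrefl andbF.
  have xw : x != w by apply: contraTneq xT => ->; rewrite inE dw andbF.
  by rewrite !in_setU1 (negbTE xw) (negbTE xv) /= inE (subsetP svS).
apply: (extend_2vertices _ pc').
  by rewrite !subUset !sub1set vA wA subsetDl.
move=> x /setDP[xA]; rewrite !in_setU1 in_setD xA andbT !negb_or negbK.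
case/and3P=> xw xv; rewrite in_setU in_set2 (negbTE xv) (negbTE xw) /= !inE.
by case/orP=> /andP[_ /eqP->].
Qed.

(** * Discharging *)
Definition sparse := forall A, A != set0 -> 7 * \sum_(v in A) deg A v < 20 * #|A|.

(** The vertices of degree at least 3 that cannot afford to pay 3 to each of
    their 2-neighbors out of the surplus [7 * deg - 20]. *)
Definition needy A v := (deg A v == 3) && (nbrs2 A v != set0) || (deg A v == 4) && (2 < #|nbrs2 A v|).

Definition transfer A u v :=
  if deg A v == 2 then 3 else (needy A v && (3 < deg A u) : nat).

Lemma transfer_le3 A u v : transfer A u v <= 3.
Proof. by rewrite /transfer; case: ifP => // _; case: (_ && _). Qed.

Lemma deg_nbrs_split A v : deg A v = #|nbrs2 A v| + #|nbrs_not2 A v|.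
Proof.
rewrite /deg -(cardsID [set w | deg A w == 2] (nbrs A v)); congr (_ + _).
  by apply: eq_card => w; rewrite !inE.
by apply: eq_card => w; rewrite !inE andbC.
Qed.

Lemma even_nbrs_split A v : #|even_nbrs A v| = #|nbrs2 A v| + #|even_nbrs A v :&: nbrs_not2 A v|.
Proof.
rewrite -(cardsID [set w | deg A w == 2] (even_nbrs A v)); congr (_ + _).
  apply: eq_card => w; rewrite !inE.
  by case: (deg A w =P 2) => [->|]; rewrite ?andbF ?andbT.
apply: eq_card => w; rewrite !inE.
by case: (w \in A); rewrite ?andbF //=; case: (adj v w); rewrite ?andbF //= andbC.
Qed.

Lemma sum_nbrs_split A v (g : G -> nat) :
  \sum_(u in nbrs A v) g u = \sum_(u in nbrs2 A v) g u + \sum_(u in nbrs_not2 A v) g u.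
Proof.
rewrite (bigID (fun w => deg A w == 2)) /=; congr (_ + _);
by apply: eq_bigl => w; rewrite !inE.
Qed.

Lemma transfer_to_nbrs2 A v : \sum_(u in nbrs2 A v) transfer A v u = 3 * #|nbrs2 A v|.
Proof.
rewrite (eq_bigr (fun=> 3)) ?sum_nat_const ?[3 * _]mulnC // => u.
by rewrite inE /transfer => /andP[_ ->].
Qed.

(** [w] is even, is adjacent to [v] and so not isolated, and has degree
    other than 2. *)
Lemma even_nbr_deg_ge4 A v w : v \in A -> w \in even_nbrs A v :&: nbrs_not2 A v -> 3 < deg A w.
Proof.
move=> vA; rewrite !inE => /andP[/andP[/andP[wA vw] ev] /andP[_ n2]].
have : 0 < deg A w by rewrite card_gt0; apply/set0Pn; exists v; rewrite in_nbrs vA adj_sym.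
by move: ev n2; case: (deg A w) => [|[|[|[|]]]].
Qed.

(** Irreducibility of stars says that the neighbors of [v] outside degree 2
    and its even neighbors together number at least 5.  At degree 3 this
    leaves at most one 2-neighbor and forces two even neighbors of degree at
    least 4, which pay for it; at degree 4 it leaves at most three 2-neighbors
    and, when there are three, makes the last neighbor an even vertex that
    pays 1 and, by irreducibility of double stars, is not itself needy.  From
    degree 5 on, [7 * d - 3 * d >= 20].  A 2-vertex has no 2-neighbor and
    receives 3 twice; degrees 0 and 1 do not occur. *)
Lemma final_charge_ge20 A v :
  (forall B, B \proper A -> colorable B) -> ~ colorable A -> v \in A ->
  20 + \sum_(u in nbrs A v) transfer A v u <= 7 * deg A v + \sum_(u in nbrs A v) transfer A u v.
Proof.
move=> IH nA vA.
have star w : w \in A -> [|| odd (deg A w), nbrs2 A w != set0 | nbrs A w == set0] ->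
    4 < #|nbrs_not2 A w| + #|even_nbrs A w|.
  move=> wA hw; rewrite ltnNge; apply/negP => le4; apply: nA.
  apply: (star_reducible wA hw le4); apply: IH; apply/properP; split; first exact: subsetDl.
  by exists w => //; rewrite !inE eqxx.
have ds w : w \in A -> adj v w -> deg A v = 4 -> deg A w = 4 -> #|nbrs2 A v| = 3 ->
    #|nbrs2 A w| = 3 -> False.
  move=> wA vw dv dw tv tw; apply: nA.
  apply: (double_star_reducible vA wA vw dv dw tv tw).
  by apply: IH; apply/properP; split; [exact: subsetDl | exists v => //; rewrite !inE eqxx].
have ltT w : w \in A -> deg A w = 4 -> #|nbrs2 A w| <= 3.
  move=> wA dw; rewrite leqNgt; apply/negP => lt3.
  have := star w wA; rewrite -card_gt0 (ltn_trans _ lt3) //= orbT => /(_ isT).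
  have := deg_nbrs_split A w; rewrite even_nbrs_split dw.
  have : #|even_nbrs A w :&: nbrs_not2 A w| <= #|nbrs_not2 A w| by rewrite subset_leq_card ?subsetIr.
  lia.
have D := deg_nbrs_split A v; have E := even_nbrs_split A v.
have Hn : deg A v = 0 -> nbrs A v == set0 by move/eqP; rewrite cards_eq0.
have sI : even_nbrs A v :&: nbrs_not2 A v \subset nbrs_not2 A v by exact: subsetIr.
have leI := subset_leq_card sI.
have starv := star v vA.
have leT : \sum_(u in nbrs A v) transfer A v u <= 3 * deg A v.
  by rewrite mulnC -sum_nat_const leq_sum // => u _; exact: transfer_le3.
have giv0 : deg A v <= 3 -> \sum_(u in nbrs A v) transfer A v u = 3 * #|nbrs2 A v|.
  move=> le3; rewrite sum_nbrs_split transfer_to_nbrs2 big1 ?addn0 // => u.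
  by rewrite inE /transfer => /andP[_ /negbTE->]; rewrite [3 < _]ltnNge le3 andbF.
have recv : deg A v != 2 -> needy A v ->
    #|even_nbrs A v :&: nbrs_not2 A v| <= \sum_(u in nbrs A v) transfer A u v.
  move=> n2 nv; rewrite -sum1_card sum_nbrs_split -[X in X <= _]add0n leq_add //.
  rewrite [X in _ <= X](bigID (mem (even_nbrs A v))) /=.
  rewrite -[X in X <= _]addn0 leq_add //.
  rewrite [X in _ <= X](eq_bigl (fun u => u \in even_nbrs A v :&: nbrs_not2 A v)); last first.
    by move=> u; rewrite [in RHS]inE andbC.
  apply: leq_sum => u uI; rewrite /transfer (negbTE n2) nv.
  by rewrite (even_nbr_deg_ge4 vA uI).
have [d5|d5] := leqP 5 (deg A v); first by lia.
move: d5; rewrite ltnS leq_eqVlt => /orP[/eqP d4|].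
  have := ltT v vA d4; rewrite leq_eqVlt => /orP[/eqP t3|t2]; last first.
    suff : \sum_(u in nbrs A v) transfer A v u <= 3 * #|nbrs2 A v| + #|nbrs_not2 A v| by lia.
    rewrite sum_nbrs_split transfer_to_nbrs2 leq_add2l -sum1_card leq_sum // => u.
    by rewrite inE /transfer => /andP[_ /negbTE->]; case: (_ && _).
  have tn0 : nbrs2 A v != set0 by rewrite -card_gt0 t3.
  have nv : needy A v by rewrite /needy d4 t3.
  have := recv _ nv; rewrite d4 => /(_ isT) rv.
  move: (starv); rewrite tn0 /= ?orbT => /(_ isT) s5.
  have eqI : even_nbrs A v :&: nbrs_not2 A v = nbrs_not2 A v.
    by apply/eqP; rewrite eqEcard sI; lia.
  have : \sum_(u in nbrs_not2 A v) transfer A v u = 0.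
    apply: big1 => u uN; rewrite -eqI in uN.
    have u4 := even_nbr_deg_ge4 vA uN.
    move: uN; rewrite !inE => /andP[/andP[/andP[uA vu] ev] /andP[_ n2]].
    rewrite /transfer (negbTE n2) /needy.
    have [u3|_] := eqVneq (deg A u) 3; first by rewrite u3 in ev.
    have [u4'|//] := eqVneq (deg A u) 4; case: ltnP => //= tu.
    by case: (ds u uA vu d4 u4' t3); apply/eqP; rewrite eqn_leq tu ltT.
  by rewrite sum_nbrs_split transfer_to_nbrs2; lia.
rewrite ltnS leq_eqVlt => /orP[/eqP d3|].
  move: starv; rewrite d3 => /(_ isT) s5; rewrite giv0 ?d3 //.
  have [t0|tn0] := eqVneq (nbrs2 A v) set0; first by rewrite t0 cards0.
  have nv : needy A v by rewrite /needy d3 tn0.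
  have := recv _ nv; rewrite d3 => /(_ isT); lia.
rewrite ltnS leq_eqVlt => /orP[/eqP d2|lt2]; last first.
  have : [|| odd (deg A v), nbrs2 A v != set0 | nbrs A v == set0].
    by case: (deg A v) lt2 Hn => [_ /(_ erefl)->|[]//]; rewrite !orbT.
  move=> /starv; lia.
have t0 : #|nbrs2 A v| = 0.
  apply/eqP; apply: contraT => tn0; move: starv; rewrite -cards_eq0 tn0 ?orbT => /(_ isT); lia.
rewrite giv0 ?d2 // t0 (eq_bigr (fun=> 3)) ?sum_nat_const -/(deg A v) ?d2 // => u _.
by rewrite /transfer d2.
Qed.

Lemma sparse_colorable A : sparse -> colorable A.
Proof.
move=> sp; move: {2}#|A| (leqnn #|A|) => n; elim: n A => [|n IH] A.
  rewrite leqn0 cards_eq0 => /eqP->; exists (fun=> ord0); split=> [x y|w]; by rewrite inE.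
move=> leA.
have IHp B : B \proper A -> colorable B.
  by move=> /proper_card ltB; apply: IH; rewrite -ltnS (leq_trans ltB).
have [A0|An0] := eqVneq A set0; first by apply: IH; rewrite A0 cards0.
apply: boolp.contrapT => nA.
have := sp A An0; rewrite ltnNge => /negP; apply.
have H : \sum_(v in A) (20 + \sum_(u in nbrs A v) transfer A v u) <=
         \sum_(v in A) (7 * deg A v + \sum_(u in nbrs A v) transfer A u v).
  by apply: leq_sum => v vA; apply: final_charge_ge20.
(* Discharging preserves the total charge. *)
have sumE : \sum_(v in A) \sum_(u in nbrs A v) transfer A u v =
            \sum_(v in A) \sum_(u in nbrs A v) transfer A v u.
  transitivity (\sum_(v in A) \sum_(u in A | adj v u) transfer A u v).
    by apply: eq_bigr => v _; apply: eq_bigl => u; rewrite in_nbrs.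
  rewrite (exchange_big_dep (mem A)) /=; last by move=> v u _ /andP[].
  apply: eq_bigr => v vA; apply: eq_bigl => u.
  by rewrite in_nbrs vA /= adj_sym.
rewrite big_split [X in _ <= X]big_split /= sumE leq_add2r sum_nat_const in H.
by rewrite mulnC big_distrr.
Qed.

End Coloring.

(** * Maximum average degree *)
Section Mad.
Variable G : sgraph.

Lemma edgeP (e : {set G}) :
  reflect (exists x y, adj x y /\ e = [set x; y]) (e \in edges G).
Proof.
rewrite inE; apply: (iffP existsP) => [[x /existsP[y /andP[xy /eqP->]]]|[x [y [xy ->]]]].
  by exists x, y.
by exists x; apply/existsP; exists y; rewrite xy eqxx.
Qed.

Lemma adj_neq (x y : G) : adj x y -> x != y.
Proof. by apply: contraTneq => ->; rewrite adj_irrefl. Qed.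

Lemma card_edge (e : {set G}) : e \in edges G -> #|e| = 2.
Proof. by move=> /edgeP[x [y [/adj_neq xy ->]]]; rewrite cards2 xy. Qed.

Lemma edge2 (x y : G) : ([set x; y] \in edges G) = adj x y.
Proof.
apply/edgeP/idP => [[a [b [ab E]]]|xy]; last by exists x, y.
have xE : x \in [set a; b] by rewrite -E !inE eqxx.
have yE : y \in [set a; b] by rewrite -E !inE eqxx orbT.
have xy : x != y.
  have := card_edge (introT (edgeP _) (ex_intro _ a (ex_intro _ b (conj ab erefl)))).
  by rewrite -E cards2; case: (x != y).
move: xE yE xy; rewrite !inE => /orP[]/eqP-> /orP[]/eqP->; rewrite ?eqxx //.
by rewrite adj_sym.
Qed.

Lemma handshake (F : {set {set G}}) (V : {set G}) :
  F \subset edges G -> (forall e, e \in F -> e \subset V) ->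
  \sum_(v in V) #|[set e in F | v \in e]| = (2 * #|F|)%N.
Proof.
move=> /subsetP sF sV.
under eq_bigr => v _ do rewrite -sum1_card.
rewrite (eq_bigr (fun v => \sum_(e in F | v \in e) 1)%N); last first.
  by move=> v _; apply: eq_bigl => e; rewrite inE.
rewrite (exchange_big_dep (mem F)) /=; last by move=> v e _ /andP[].
rewrite (eq_bigr (fun=> 2%N)) ?sum_nat_const 1?mulnC // => e eF.
rewrite -(card_edge (sF _ eF)) -sum1_card; apply: eq_bigl => v.
by rewrite eF /=; case: (boolP (v \in e)) => [/(subsetP (sV e eF))->|]; rewrite ?andbF.
Qed.

Lemma card_incident (A : {set G}) v : v \in A ->
  #|[set e in [set e in edges G | e \subset A] | v \in e]| = deg A v.
Proof.
move=> vA; rewrite /deg -(@card_in_imset _ _ (fun y => [set v; y])); last first.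
  move=> y z; rewrite !in_nbrs => /andP[_ vy] /andP[_ vz] E.
  have : y \in [set v; z] by rewrite -E !inE eqxx orbT.
  by rewrite !inE eq_sym (negbTE (adj_neq vy)) => /eqP.
apply: eq_card => e; rewrite in_set in_set; apply/idP/imsetP.
  move=> /andP[/andP[/edgeP[x [y [xy ->]]]]]; rewrite subUset !sub1set.
  case/andP=> xA yA; rewrite in_set2 => /orP[]/eqP Ev; subst v.
    by exists y => //; rewrite in_nbrs yA.
  by exists x; rewrite ?in_nbrs ?xA 1?adj_sym // setUC.
move=> [y]; rewrite in_nbrs => /andP[yA vy] ->.
by rewrite edge2 vy subUset !sub1set vA yA set21.
Qed.

Lemma sparse_of_mad : (mad G < 20 / 7)%R -> sparse G.
Proof.
move=> madG A A0; pose F := [set e in edges G | e \subset A].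
have sF : F \subset edges G by apply/subsetP => e; rewrite inE => /andP[].
have sA e : e \in F -> e \subset A by rewrite inE => /andP[].
have <- : \sum_(v in A) #|[set e in F | v \in e]| = \sum_(v in A) deg A v.
  by apply: eq_bigr => v /card_incident.
rewrite (handshake sF sA).
have HA : ((A, F).1 != set0) && subgraph (A, F).
  by rewrite A0 /subgraph /= sF; apply/forall_inP.
have := le_lt_trans (le_bigmax_cond 0%R
  (fun H : {set G} * {set {set G}} => (2 * #|H.2|)%N%:R / #|H.1|%:R : rat)%R HA) madG.
have A_gt0 : (0 < #|A|%:R :> rat)%R by rewrite ltr0n card_gt0.
rewrite /= ltr_pdivrMr // mulrAC ltr_pdivlMr // -!natrM ltr_nat.
by rewrite [(7 * _)%N]mulnC.
Qed.

Lemma mad_lt (q : rat) : (0 < q)%R ->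
  (forall V (F : {set {set G}}), V != set0 -> F \subset edges G ->
     (forall e, e \in F -> e \subset V) -> (2 * #|F|)%N%:R < q * #|V|%:R)%R ->
  (mad G < q)%R.
Proof.
move=> q0 H; apply/bigmax_ltP; split=> // -[V F] /andP[/= V0 /andP[/= sF /forall_inP sV]].
rewrite ltr_pdivrMr ?ltr0n ?card_gt0 //; exact: H.
Qed.

Lemma chi_o_le5 : sparse G -> chi_o G <= 5.
Proof.
move=> sp; have [c [pc oc]] := sparse_colorable setT sp.
rewrite /chi_o; case: ex_minnP => n _; apply.
apply/existsP; exists [ffun x => c x]; apply/andP; split.
  apply/forallP => x; apply/forallP => y; apply/implyP => xy.
  by rewrite !ffunE pc ?inE.
apply/forallP => v; apply/implyP => v0.
have nbE : nbrs setT v = nbhd v by apply/setP => u; rewrite !inE.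
have := oc v (in_setT _); rewrite nbE subsetT => /(_ v0 isT) /existsP[i oi].
apply/existsP; exists i; congr (odd _): oi; rewrite nbE.
by apply: eq_card => u; rewrite !inE ffunE.
Qed.

End Mad.

(** * Even edge sets and their cycles *)
Notation "\xor_ ( i | P ) F" := (\big[addb/false]_(i | P%B) F)
  (at level 36, i at level 50, F at level 36, format "\xor_ ( i  |  P )  F").
Notation "\xor_ ( i 'in' A | P ) F" := (\big[addb/false]_(i in A | P%B) F)
  (at level 36, i, A at level 50, F at level 36, format "\xor_ ( i  'in'  A  |  P )  F").
Notation "\xor_ ( i 'in' A ) F" := (\big[addb/false]_(i in A) F)
  (at level 36, i, A at level 50, F at level 36, format "\xor_ ( i  'in'  A )  F").

Lemma odd_card_xor (T : finType) (P Q : pred T) :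
  odd #|[set x | P x && Q x]| = \xor_(x | P x) Q x.
Proof.
rewrite -sum1_card (big_morph odd oddD (erefl : odd 0 = false)).
rewrite (eq_bigl (fun x => P x && Q x)); last by move=> x; rewrite inE.
by rewrite big_mkcondr; apply: eq_bigr => x _; case: (Q x).
Qed.

Lemma xor_single (T : finType) (P : pred T) (F : T -> bool) x0 :
  P x0 -> (forall x, P x -> x != x0 -> F x = false) -> \xor_(x | P x) F x = F x0.
Proof. by move=> P0 F0; rewrite (bigD1 x0) //= big1 ?addbF // => x /andP[]; exact: F0. Qed.

Section LongCycle.
Variables (T : finType) (r : rel T).
Hypotheses (r_sym : symmetric r) (r_irr : irreflexive r).
Hypothesis r_two : forall x y, r x y -> exists2 z, r x z & z != y.

(** In a finite graph where no vertex has exactly one neighbor, a path that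
    cannot be prolonged beyond its first vertex closes up: a second neighbor
    of that vertex lies on the path. *)
Lemma exists_cycle x0 y0 : r x0 y0 -> exists p, 2 < size p /\ ucycle r p.
Proof.
move=> r0.
suff [//|H] : (exists p, 2 < size p /\ ucycle r p) \/
    forall n, exists x y p, [/\ path r x (y :: p), uniq (x :: y :: p) & size p = n].
  have [x [y [p [_ unq sp]]]] := H #|T|.
  have : size (x :: y :: p) <= #|T| by rewrite -(card_uniqP unq) max_card.
  by rewrite /= sp => /ltnW; rewrite ltnn.
apply: boolp.contrapT => nH; apply: (nH); right.
elim=> [|n [x [y [p [pth unq sp]]]]].
  exists x0, y0, [::]; rewrite /= r0 inE; split=> //.
  by rewrite andbT; apply: contraTneq r0 => ->; rewrite r_irr.
have rxy : r x y by case/andP: pth.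
have [z xz zy] := r_two rxy.
have [zp|zp] := boolP (z \in p); last first.
  exists z, x, (y :: p); split.
  - by rewrite /= r_sym xz; exact: pth.
  - rewrite cons_uniq unq andbT !inE (negbTE zy) (negbTE zp) !orbF.
    by apply: contraTneq xz => ->; rewrite r_irr.
  - by rewrite /= sp.
exfalso; apply: nH; left.
move: pth unq sp; case/path.splitP: zp => p1 p2; rewrite -!cat_cons.
move=> pth unq _; exists [:: x, y & rcons p1 z]; split.
  by rewrite /= size_rcons.
rewrite /ucycle /cycle rcons_path; apply/andP; split.
  move: pth; rewrite /= cat_path => /andP[-> /andP[-> _]] /=.
  by rewrite last_rcons r_sym.
by move: unq; rewrite cat_uniq => /andP[].
Qed.

End LongCycle.

Section EvenSets.
Variable G : sgraph.
Implicit Types (F z : {set {set G}}) (V : {set G}).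

Definition even_set z := forall u : G, \xor_(e in z) (u \in e) = false.

Lemma even_setP z : even_set z -> forall u, ~~ odd #|[set e in z | u \in e]|.
Proof. by move=> ev u; rewrite odd_card_xor ev. Qed.

(** An even set contains a cycle, and each vertex of the cycle meets at least
    two edges of the set, so by the handshake identity there are at least as
    many edges in the set as vertices on the cycle. *)
Lemma even_set_card k z : (forall p : seq G, graph_cycle p -> k <= size p) ->
  z \subset edges G -> even_set z -> z != set0 -> k <= #|z|.
Proof.
move=> girth_k /subsetP sz ev /set0Pn[e0 e0z].
pose r x y := [set x; y] \in z.
have r_sym : symmetric r by move=> x y; rewrite /r setUC.
have r_adj : subrel r (@adj G) by move=> x y /sz; rewrite edge2.
have r_irr : irreflexive r by move=> x; apply/negP => /r_adj; rewrite adj_irrefl.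
have r_two x y : r x y -> exists2 w, r x w & w != y.
  move=> xy; have /= := even_setP ev x.
  rewrite (cardsD1 [set x; y]) in_set -/(r x y) xy set21 /= negbK => /odd_gt0.
  rewrite card_gt0 => /set0Pn[e]; rewrite in_setD1 inE => /and3P[ne ez xe].
  have /edgeP[a [b [ab E]]] := sz e ez; subst e.
  move: xe; rewrite in_set2 => /orP[]/eqP Ex; subst x.
    by exists b => //; apply: contra ne => /eqP->.
  by exists a; [rewrite r_sym | apply: contra ne => /eqP->; rewrite setUC].
have /edgeP[x0 [y0 [_ E0]]] := sz e0 e0z; rewrite E0 in e0z.
have [p [p2 /andP[cyc unq]]] := exists_cycle r_sym r_irr r_two e0z.
have kp : k <= size p by apply: girth_k; split=> //; rewrite /ucycle unq (sub_cycle r_adj cyc).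
apply: leq_trans kp _; rewrite -(card_uniqP unq).
pose V := \bigcup_(e in z) e.
have sV e : e \in z -> e \subset V by exact: bigcup_sup.
rewrite -(leq_pmul2l (isT : 0 < 2)) -(handshake (introT subsetP sz) sV) mulnC -sum_nat_const.
have pV x : x \in p -> exists2 e, e \in z & x \in e.
  by move=> xp; exists [set x; next p x]; rewrite ?set21 //; exact: next_cycle cyc xp.
rewrite [X in _ <= X](bigID [in p]) /= -[X in X <= _]addn0 leq_add //.
rewrite [X in _ <= X](eq_bigl [in p]); last first.
  move=> x; rewrite /= andbC; case: (boolP (x \in p)) => //= /pV[e ez xe].
  by apply/bigcupP; exists e.
apply: leq_sum => x /pV[e ez xe].
have : 0 < #|[set e in z | x \in e]| by rewrite card_gt0; apply/set0Pn; exists e; rewrite inE ez.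
by have := even_setP ev x; case: #|_| => [|[|]].
Qed.

(** The counting behind Euler's formula, for an abstract set [Q] of faces in
    which [s e] and [t e] are the faces on the two sides of [e].  Sending an
    edge set to the vertices other than a fixed [v0] where it is odd has
    fibers no larger than the family [Z] of even sets, so
    [2 ^ #|F| <= 2 ^ (#|V| - 1) * #|Z|].  As every even set comes from a set
    of faces with nonempty boundary, [#|Z| <= 2 ^ f] for the number [f] of
    such faces.  Finally [k * f <= 2 * #|F|] because an edge has two sides. *)
Lemma two_sided_bound (Q : finType) (s t : {set G} -> Q) k F V :
  F \subset edges G -> (forall e, e \in F -> e \subset V) -> V != set0 ->
  (forall rho, even_set [set e in F | (s e == rho) (+) (t e == rho)]) ->
  (forall z, z \subset F -> even_set z ->
     exists w : Q -> bool, forall e, e \in F -> (e \in z) = w (s e) (+) w (t e)) ->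
  (forall z, z \subset F -> even_set z -> z != set0 -> k <= #|z|) ->
  k * #|F|.+1 <= 2 * #|F| + k * #|V|.
Proof.
move=> sF sV /set0Pn[v0 v0V] bd span gir.
pose bdry rho := [set e in F | (s e == rho) (+) (t e == rho)].
pose Q' := [set rho | bdry rho != set0].
(* Count the pairs of an edge and a face with that edge on its boundary. *)
have cover : k * #|Q'| <= 2 * #|F|.
  rewrite mulnC -sum_nat_const.
  apply: (@leq_trans (\sum_(rho in Q') #|bdry rho|)).
    apply: leq_sum => rho; rewrite inE => ne; apply: gir => //.
      by apply/subsetP => e; rewrite inE => /andP[].
    exact: bd.
  under eq_bigr => rho _ do rewrite -sum1_card.
  rewrite (exchange_big_dep [in F]) /=; last by move=> rho e _; rewrite inE => /andP[].
  rewrite mulnC -[X in _ <= X]sum_nat_const leq_sum // => e eF.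
  rewrite sum1_card (@leq_trans #|[set s e; t e]|) //; last by rewrite cards2; case: (_ != _).
  apply: subset_leq_card; apply/subsetP => rho /andP[_]; rewrite in_set in_set2 => /andP[_].
  by rewrite ![rho == _]eq_sym; case: (s e == rho); case: (t e == rho).
pose sd z1 z2 : {set {set G}} := [set e | (e \in z1) (+) (e \in z2)].
have xor_sd z1 z2 u : \xor_(e in sd z1 z2) (u \in e) =
    \xor_(e in z1) (u \in e) (+) \xor_(e in z2) (u \in e).
  rewrite (big_mkcond [in z1]) (big_mkcond [in z2]) [LHS]big_mkcond -big_split /=; apply: eq_bigr => e _.
  by rewrite inE; case: (e \in z1); case: (e \in z2); case: (u \in e).
pose Z := [set z in powerset F | [forall u, \xor_(e in z) (u \in e) == false]].
have inZ z : (z \in Z) -> z \subset F /\ even_set z.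
  by rewrite !inE => /andP[-> /forallP h]; split=> // u; apply/eqP.
(* An even set is determined by the faces of [Q'] where its function [w] holds:
   an edge with two different sides has both of them in [Q']. *)
have leZ : #|Z| <= 2 ^ #|Q'|.
  rewrite -card_powerset.
  pose sig (W : {set Q}) := [set e in F | (s e != t e) && ((s e \in W) (+) (t e \in W))].
  apply: (@leq_trans #|sig @: powerset Q'|); last exact: leq_imset_card.
  apply: subset_leq_card; apply/subsetP => z /inZ[zF ez].
  have [w wE] := span z zF ez.
  apply/imsetP; exists [set rho in Q' | w rho].
    by rewrite inE; apply/subsetP => rho; rewrite inE => /andP[].
  apply/setP => e; rewrite inE; case: (boolP (e \in F)) => [eF|eF] /=; last first.
    by apply: contraNF eF; exact: (subsetP zF).
  rewrite (wE _ eF); have [->|ne] := eqVneq (s e) (t e); first by rewrite addbb.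
  have sQ : s e \in Q'.
    rewrite inE; apply/set0Pn; exists e.
    by rewrite inE eF eqxx [t e == _]eq_sym (negbTE ne).
  have tQ : t e \in Q' by rewrite inE; apply/set0Pn; exists e; rewrite inE eF eqxx (negbTE ne).
  by rewrite /= !inE /=; move: sQ tQ; rewrite !inE => -> ->.
pose od z := [set u in V :\ v0 | \xor_(e in z) (u \in e)].
(* Adding a fixed element of a fiber of [od] maps that fiber into [Z]. *)
have lower : 2 ^ #|F| <= 2 ^ #|V|.-1 * #|Z|.
  have -> : #|V|.-1 = #|V :\ v0| by rewrite (cardsD1 v0 V) v0V.
  rewrite -!card_powerset -sum1_card (partition_big od [in powerset (V :\ v0)]) /=; last first.
    by move=> z _; rewrite inE; apply/subsetP => u; rewrite inE => /andP[].
  rewrite -sum_nat_const leq_sum // => P _.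
  have [E0|[z0]] := set_0Vmem [set z in powerset F | od z == P].
    rewrite big1 // => z zP; have : z \in [set z in powerset F | od z == P] by rewrite inE.
    by rewrite E0 inE.
  rewrite inE => /andP[z0F /eqP z0P].
  rewrite sum1_card -(card_in_imset (f := sd z0)); last first.
    move=> z1 z2 _ _ /setP E12; apply/setP => e; have := E12 e; rewrite !inE.
    by case: (e \in z0); case: (e \in z1); case: (e \in z2).
  apply: subset_leq_card; apply/subsetP => _ /imsetP[z /andP[zF /eqP zP] ->].
  have odd0 u : u \in V :\ v0 -> \xor_(e in sd z0 z) (u \in e) = false.
    move=> uV; rewrite xor_sd; have := z0P; rewrite -zP => /setP/(_ u).
    by rewrite ![_ \in od _]inE uV /= => ->; rewrite addbb.
  have sdF : sd z0 z \subset F.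
    apply/subsetP => e; rewrite inE; move: z0F zF; rewrite !powersetE => /subsetP/(_ e) h /subsetP/(_ e).
    by move: h; case: (e \in z0); case: (e \in z) => //= [/(_ isT)|_ /(_ isT)].
  rewrite inE powersetE sdF; apply/forallP => u; apply/eqP.
  have [uV|uV] := boolP (u \in V); last first.
    rewrite big1 // => e /(subsetP sdF) eF; apply: contraNF uV; exact/subsetP/sV.
  have [->|uv0] := eqVneq u v0; last by apply: odd0; rewrite !inE uv0.
  (* Parity at [v0] follows from the other vertices, since edges have two ends. *)
  have : \xor_(e in sd z0 z) odd #|e| = false.
    by rewrite big1 // => e /(subsetP sdF)/(subsetP sF)/card_edge ->.
  rewrite (eq_bigr (fun e : {set G} => \xor_(u in V) (u \in e))); last first.
    move=> e /(subsetP sdF)/sV seV; rewrite -odd_card_xor; congr odd.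
    apply: eq_card => w; rewrite inE; apply/idP/andP => [we|[]//].
    by split=> //; apply: (subsetP seV).
  rewrite exchange_big /= (bigD1 v0) //= [X in _ (+) X]big1 ?addbF //.
  by move=> w /andP[wV wv]; apply: odd0; rewrite !inE wv.
have : 2 ^ #|F| <= 2 ^ (#|V|.-1 + #|Q'|).
  by rewrite expnD (leq_trans lower) // leq_mul2l leZ orbT.
rewrite leq_exp2l // => leF.
have V0 : 0 < #|V| by rewrite card_gt0; apply/set0Pn; exists v0.
have : #|F|.+1 <= #|V| + #|Q'| by lia.
move/(leq_mul (leqnn k)) => /leq_trans -> //.
by rewrite mulnDr addnC leq_add2r.
Qed.

End EvenSets.

(** * Crossing parities in the grid *)
Lemma xor_sym_pairs (T : finType) (S : {set T}) (g : T -> T -> bool) :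
  (forall x y, g x y = g y x) -> (forall x, g x x = false) ->
  \xor_(x in S) \xor_(y in S) g x y = false.
Proof.
move=> gC g0.
have split_sum x : \xor_(y in S) g x y =
    \xor_(y in S | enum_rank x < enum_rank y) g x y (+)
    \xor_(y in S | enum_rank y < enum_rank x) g x y.
  rewrite !big_mkcondr -big_split /=; apply: eq_bigr => y _.
  case: ltngtP => [//||/val_inj/enum_rank_inj->]; rewrite ?addbF ?g0 //.
rewrite (eq_bigr _ (fun x _ => split_sum x)) big_split /=.
rewrite [X in _ (+) X](exchange_big_dep [in S]) /=; last by move=> x y _ /andP[].
rewrite -[RHS](addbb (\xor_(x in S) \xor_(y in S | enum_rank x < enum_rank y) g x y)).
congr (_ (+) _); apply: eq_bigr => x xS; apply: eq_big => [y|y _]; last exact: gC.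
by rewrite xS.
Qed.

Notation point := (nat * nat)%type.

Section Grid.
Implicit Types (p q : point).

Definition gstep p q : bool :=
  ((p.1 == q.1) && ((p.2 == q.2.+1) || (q.2 == p.2.+1)))
  || ((p.2 == q.2) && ((p.1 == q.1.+1) || (q.1 == p.1.+1))).

(** The two unit squares along a grid edge.  A unit square is named by its
    upper right corner, so that the squares around a grid point of positive
    coordinates all have natural coordinates. *)
Definition side1 p q : point :=
  if p.1 == q.1 then (p.1, (minn p.2 q.2).+1) else ((minn p.1 q.1).+1, p.2).
Definition side2 p q : point :=
  if p.1 == q.1 then (p.1.+1, (minn p.2 q.2).+1) else ((minn p.1 q.1).+1, p.2.+1).

Definition same_edge (a : point * point) p q : bool :=
  (a == (p, q)) || (a == (q, p)).

(** Whether a step crosses the leftward horizontal ray from the center of the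
    square [s]. *)
Definition cross (s : point) p q : bool :=
  [&& p.1 == q.1, (minn p.2 q.2).+1 == s.2 & p.1 < s.1].

(** For a vertical edge [a] the rays from its two sides differ by [a] only.
    For a horizontal edge they run along two consecutive rows, and a step
    crosses exactly one of them when it enters or leaves the half-line of grid
    points between the two rows; this is the indicator of that half-line. *)
Definition ray_end (a : point * point) p : bool :=
  [&& a.1.1 != a.2.1, p.2 == a.1.2 & p.1 <= minn a.1.1 a.2.1].

Lemma gstepP p q : gstep p q -> exists i j,
  [\/ p = (i, j) /\ q = (i, j.+1), p = (i, j.+1) /\ q = (i, j),
      p = (i, j) /\ q = (i.+1, j) | p = (i.+1, j) /\ q = (i, j)].
Proof.
case: p q => [p1 p2] [q1 q2] /orP[]/andP[/= /eqP-> /orP[]/eqP->].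
- by exists q1, q2; constructor 2.
- by exists q1, p2; constructor 1.
- by exists q1, q2; constructor 4.
- by exists p1, q2; constructor 3.
Qed.
Lemma eqn_succr (n : nat) : (n == n.+1) = false. Proof. lia. Qed.
Lemma eqn_succl (n : nat) : (n.+1 == n) = false. Proof. lia. Qed.
Lemma minn_succr (n : nat) : minn n n.+1 = n. Proof. lia. Qed.


Lemma gstepW (P : point -> point -> Prop) : (forall p q, gstep p q -> P p q -> P q p) ->
  (forall i j, P (i, j) (i, j.+1)) -> (forall i j, P (i, j) (i.+1, j)) ->
  forall p q, gstep p q -> P p q.
Proof.
move=> PC Pv Ph p q /gstepP[i [j []]] [-> ->] //; apply: PC => //.
  by rewrite /gstep !eqxx orbT.
by rewrite /gstep !eqxx !orbT.
Qed.

Lemma gstepC p q : gstep p q = gstep q p.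
Proof.
by rewrite /gstep [q.1 == p.1]eq_sym [q.2 == p.2]eq_sym
  [(q.2 == _) || _]orbC [(q.1 == _) || _]orbC.
Qed.

Lemma sidesC p q : gstep p q -> (side1 p q = side1 q p) * (side2 p q = side2 q p).
Proof.
move: p q; apply: gstepW => [p q _ [-> ->] //|i j|i j]; rewrite /side1 /side2 /= ?eqxx ?eqn_succr ?eqn_succl.
  by rewrite minnC.
by rewrite minnC.
Qed.

Lemma crossC s p q : cross s p q = cross s q p.
Proof. by rewrite /cross minnC eq_sym; case: eqP => //= ->. Qed.

Lemma same_edgeC e p q : same_edge e p q = same_edge e q p.
Proof. by rewrite /same_edge orbC. Qed.

Lemma same_edgeCl x y p q : same_edge (x, y) p q = same_edge (y, x) p q.
Proof. by rewrite /same_edge orbC !xpair_eqE [(y == p) && _]andbC [(y == q) && _]andbC. Qed.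

Lemma ray_endC p x y : gstep x y -> ray_end (x, y) p = ray_end (y, x) p.
Proof.
move: x y; apply: gstepW => [x y _ -> //|i j|i j]; rewrite /ray_end /= ?eqxx ?eqn_succr ?eqn_succl //.
by rewrite minnC.
Qed.

(** Crossing parities of the two sides of [a] agree except for steps along
    [a], up to a term that telescopes along a walk. *)
Lemma cross_sides (a : point * point) p q : gstep a.1 a.2 -> gstep p q ->
  cross (side1 a.1 a.2) p q (+) cross (side2 a.1 a.2) p q =
  same_edge a p q (+) (ray_end a p (+) ray_end a q).
Proof.
case: a => x y /= xy pq.
move: p q pq; apply: gstepW => [p q _|i j|i j].
- by rewrite ![cross _ q p]crossC same_edgeC [ray_end _ q (+) _]addbC.
- move: x y xy; apply: gstepW => [x y xy|k l|k l].
  + by rewrite ![side1 y x]sidesC ?[side2 y x]sidesC 1?gstepC // (same_edgeCl x) !(ray_endC _ xy).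
  + rewrite /cross /same_edge /ray_end /side1 /side2 /= !xpair_eqE /= !eqxx !minn_succr /= addbF eqSS.
    rewrite ltnS [k == i]eq_sym [l == j]eq_sym.
    have [->|ne] := eqVneq j l; rewrite ?eqn_succr ?eqxx ?andbF /=; first by case: ltngtP.
    lia.
  + rewrite /cross /same_edge /ray_end /side1 /side2 /= !xpair_eqE /= !eqxx eqn_succr !minn_succr /=.
    rewrite ltnS. have [<-|ne] := eqVneq j.+1 l; first by rewrite ?eqn_succr ?eqn_succl ?eqxx ?andbF /=; lia.
    rewrite eqSS. lia.
- move: x y xy; apply: gstepW => [x y xy|k l|k l].
  + by rewrite ![side1 y x]sidesC ?[side2 y x]sidesC 1?gstepC // (same_edgeCl x) !(ray_endC _ xy).
  + rewrite /cross /same_edge /ray_end /side1 /side2 /= !xpair_eqE /= !eqxx !eqn_succr !minn_succr /=. lia.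
  + rewrite /cross /same_edge /ray_end /side1 /side2 /= !xpair_eqE /= !eqn_succr !minn_succr /=. lia.
Qed.

Fixpoint walk_parity (h : point -> point -> bool) p (l : seq point) : bool :=
  if l is q :: l' then h p q (+) walk_parity h q l' else false.

Lemma cross_sides_walk (a : point * point) p l : gstep a.1 a.2 -> path gstep p l ->
  walk_parity (cross (side1 a.1 a.2)) p l (+) walk_parity (cross (side2 a.1 a.2)) p l =
  walk_parity (same_edge a) p l (+) (ray_end a p (+) ray_end a (last p l)).
Proof.
move=> sa; elim: l p => [|q l IH] p /=; first by rewrite addbb.
case/andP=> pq /IH{}IH; rewrite addbACA IH cross_sides //.
by case: (same_edge _ _ _); case: (walk_parity _ _ _); case: (ray_end a p); case: (ray_end a q);
  case: (ray_end _ _).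
Qed.

Lemma walk_parity0 h p l (C : pred point) : (forall x y, C x -> C y -> h x y = false) ->
  all C (p :: l) -> walk_parity h p l = false.
Proof.
move=> h0; elim: l p => [//|q l IH] p /= /and3P[Cp Cq al].
by rewrite h0 // IH //= Cq.
Qed.

(** A minor model of [G] in the integer grid: the branch sets are the fibers
    of [lab], rooted at the points [c v].  Positive coordinates below [M] keep
    all neighboring points and squares in a finite box. *)
Definition grid_minor (G : sgraph) (lab : point -> option G) (c : G -> point) (M : nat) :=
  [/\ forall p v, lab p = Some v -> (0 < p.1 < M) && (0 < p.2 < M),
      forall p v, lab p = Some v -> exists l,
        [/\ path gstep (c v) l, last (c v) l = p & all (fun q => lab q == Some v) (c v :: l)] &
      forall x y, adj x y -> exists p q, [/\ gstep p q, lab p = Some x & lab q = Some y]].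

End Grid.

(** * Faces of a grid minor *)
Section Minor.
Implicit Types (p q : point).
Variables (G : sgraph) (lab : point -> option G) (c : G -> point) (M : nat).
Hypothesis minor : grid_minor lab c M.
Variables (F : {set {set G}}).
Hypothesis sF : F \subset edges G.

Notation pt := ('I_M.+1 * 'I_M.+1)%type.
Notation sq := ('I_M.+2 * 'I_M.+2)%type.
Definition pt_val (p : pt) : point := (nat_of_ord p.1, nat_of_ord p.2).
Definition sq_val (s : sq) : point := (nat_of_ord s.1, nat_of_ord s.2).
Definition to_pt (p : point) : pt := (inord p.1, inord p.2).
Definition to_sq (p : point) : sq := (inord p.1, inord p.2).

Lemma pt_valK : cancel pt_val to_pt.
Proof. by case=> i j; rewrite /to_pt /= !inord_val. Qed.
Lemma to_ptK p : (p.1 <= M) -> (p.2 <= M) -> pt_val (to_pt p) = p.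
Proof. by case: p => i j /= hi hj; rewrite /pt_val /= !inordK. Qed.
Lemma to_sqK p : (p.1 <= M.+1) -> (p.2 <= M.+1) -> sq_val (to_sq p) = p.
Proof. by case: p => i j /= hi hj; rewrite /sq_val /= !inordK. Qed.

Lemma edge_gate (e : {set G}) : exists a : point * point, e \in edges G ->
  gstep a.1 a.2 /\ exists x y, [/\ x != y, e = [set x; y], lab a.1 = Some x & lab a.2 = Some y].
Proof.
have [eE|] := boolP (e \in edges G); last by exists ((0, 0), (0, 0)).
have [x [y [xy E]]] := edgeP _ eE.
have [_ _ /(_ x y xy)[p [q [pq lp lq]]]] := minor.
by exists (p, q) => _; split=> //; exists x, y; rewrite adj_neq.
Qed.

Lemma class_route p : exists l, forall v, lab p = Some v ->
  [/\ path gstep (c v) l, last (c v) l = p & all (fun q => lab q == Some v) (c v :: l)].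
Proof.
case E : (lab p) => [v|]; last by exists [::].
have [_ /(_ p v E)[l hl] _] := minor.
by exists l => w [<-].
Qed.

(** [gate e] is the grid edge selected to represent [e], and [route p] a walk
    to [p] from the center of its set, inside that set. *)
Section Gates.
Variables (gate : {set G} -> point * point) (route : point -> seq point).
Hypothesis gateP : forall e, e \in edges G ->
  gstep (gate e).1 (gate e).2 /\
  exists x y, [/\ x != y, e = [set x; y], lab (gate e).1 = Some x & lab (gate e).2 = Some y].
Hypothesis routeP : forall p v, lab p = Some v ->
  [/\ path gstep (c v) (route p), last (c v) (route p) = p & all (fun q => lab q == Some v) (c v :: (route p))].

(** The grid edges that may separate faces. *)
Definition blocked p q : bool :=
  ((lab p == lab q) && (lab p != None)) || [exists e in F, same_edge (gate e) p q].

Definition fadj1 (s t : sq) : bool :=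
  [exists p : pt, exists q : pt, [&& gstep (pt_val p) (pt_val q), ~~ blocked (pt_val p) (pt_val q),
     s == to_sq (side1 (pt_val p) (pt_val q)) & t == to_sq (side2 (pt_val p) (pt_val q))]].
Definition fadj (s t : sq) : bool := fadj1 s t || fadj1 t s.

Definition face (p : point) : sq := fingraph.root fadj (to_sq p).

Lemma fadj_sym : symmetric fadj.
Proof. by move=> s t; rewrite /fadj orbC. Qed.

Lemma face_unblocked (p q : pt) : gstep (pt_val p) (pt_val q) -> ~~ blocked (pt_val p) (pt_val q) ->
  face (side1 (pt_val p) (pt_val q)) = face (side2 (pt_val p) (pt_val q)).
Proof.
move=> pq nb; apply/(fingraph.rootP (sym_connect_sym fadj_sym))/connect1/orP; left.
by apply/existsP; exists p; apply/existsP; exists q; rewrite pq nb !eqxx.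
Qed.

Lemma lab_same_edge e p q : e \in F -> same_edge (gate e) p q ->
  exists x y, [/\ x != y, e = [set x; y], lab p = Some x & lab q = Some y].
Proof.
move=> /(subsetP sF)/gateP[_ [x [y [xy E lx ly]]]] /orP[]/eqP Ea; move: lx ly; rewrite Ea /= => lx ly.
  by exists x, y.
by exists y, x; rewrite eq_sym setUC.
Qed.

Definition jump rho p q : bool := (face (side1 p q) == rho) (+) (face (side2 p q) == rho).

Lemma jumpC rho p q : gstep p q -> jump rho p q = jump rho q p.
Proof. by move=> pq; rewrite /jump !(sidesC pq). Qed.

Lemma pt_val_eq y p : p.1 <= M -> p.2 <= M -> (y == to_pt p) = (pt_val y == p).
Proof. by move=> h1 h2; apply/eqP/eqP => [->|<-]; rewrite ?to_ptK ?pt_valK. Qed.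

Lemma xor_neighbours (i j : nat) (g : point -> bool) : 0 < i < M -> 0 < j < M ->
  \xor_(y | gstep (i, j) (pt_val y)) g (pt_val y) =
  g (i.+1, j) (+) (g (i.-1, j) (+) (g (i, j.+1) (+) g (i, j.-1))).
Proof.
move=> /andP[i0 iM] /andP[j0 jM]; have [iM' jM'] := (ltnW iM, ltnW jM).
have [hi hj] := (leq_trans (leq_pred i) iM', leq_trans (leq_pred j) jM').
rewrite (bigD1 (to_pt (i.+1, j))) /=; last by rewrite to_ptK //= /gstep /= !eqxx !orbT.
rewrite (bigD1 (to_pt (i.-1, j))) /=; last first.
  rewrite pt_val_eq // to_ptK // /gstep xpair_eqE /=; lia.
rewrite (bigD1 (to_pt (i, j.+1))) /=; last first.
  rewrite !pt_val_eq // !to_ptK // /gstep !xpair_eqE /=; lia.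
rewrite (bigD1 (to_pt (i, j.-1))) /=; last first.
  rewrite !pt_val_eq // !to_ptK // /gstep !xpair_eqE /=; lia.
rewrite big1 ?addbF; first by rewrite !to_ptK.
move=> y; rewrite !pt_val_eq //; case: (pt_val y) => y1 y2; rewrite !xpair_eqE /gstep /=; lia.
Qed.

(** The four squares around a grid point each border two of the four edges at
    that point, so they cancel. *)
Lemma jump_vertex rho (p : pt) v : lab (pt_val p) = Some v ->
  \xor_(q | gstep (pt_val p) (pt_val q)) jump rho (pt_val p) (pt_val q) = false.
Proof.
move=> lp; have [/(_ _ _ lp)/andP[]] := minor; move: p {lp} => [i j] /= hi hj _ _.
rewrite (xor_neighbours (fun q => jump rho (nat_of_ord i, nat_of_ord j) q)) //.
rewrite /jump /side1 /side2 /= !eqxx.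
have -> : (nat_of_ord i == i.+1) = false by lia.
have -> : (nat_of_ord i == i.-1) = false by lia.
have -> : minn i i.+1 = i by lia.
have -> : (minn i i.-1).+1 = i by lia.
have -> : minn j j.+1 = j by lia.
have -> : (minn j j.-1).+1 = j by lia.
by do 4 case: (face _ == rho).
Qed.

Lemma gate_pts e : e \in F -> exists p q : pt, pt_val p = (gate e).1 /\ pt_val q = (gate e).2.
Proof.
move=> eF; have [_ [x [y [_ _ lx ly]]]] := gateP (subsetP sF _ eF).
have [hb _ _] := minor; have := hb _ _ lx; have := hb _ _ ly.
by exists (to_pt (gate e).1), (to_pt (gate e).2); rewrite !to_ptK //; lia.
Qed.

(** Sum [jump_vertex] over the connected set of [u].  Edges with both ends in
    the set are counted twice; an edge leaving the set contributes only if it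
    is a gate, and the gates leaving it are those of the edges at [u]. *)
Lemma face_boundary_even rho :
  even_set [set e in F | jump rho (gate e).1 (gate e).2].
Proof.
move=> u.
pose S := [set p : pt | lab (pt_val p) == Some u].
pose J (p q : pt) := gstep (pt_val p) (pt_val q) && jump rho (pt_val p) (pt_val q).
have JC (p q : pt) : J p q = J q p.
  by rewrite /J gstepC; case: (boolP (gstep _ _)) => //= h; rewrite [RHS]jumpC.
have J0 (p : pt) : J p p = false.
  by rewrite /J /gstep !eqxx !eqn_succr.
have tot : \xor_(p in S) \xor_(q | true) J p q = false.
  apply: big1 => p; rewrite inE => /eqP lp.
  by rewrite -[RHS](jump_vertex rho lp) [RHS]big_mkcond; apply: eq_bigr.
have cut : \xor_(p in S) \xor_(q in ~: S) J p q = false.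
  have : \xor_(p in S) (\xor_(q in S) J p q (+) \xor_(q in ~: S) J p q) = false.
    rewrite -[RHS]tot; apply: eq_bigr => p _ /=; rewrite [RHS](bigID [in S]) /=.
    by congr (_ (+) _); apply: eq_bigl => q; rewrite in_setC.
  by rewrite big_split /= (xor_sym_pairs _ JC J0) addFb.
(* An edge leaving the set of [u] separates two faces only if it is a gate. *)
have JE (p q : pt) : p \in S -> q \notin S ->
    J p q = \xor_(e in F) (same_edge (gate e) (pt_val p) (pt_val q) && jump rho (gate e).1 (gate e).2).
  rewrite !inE => /eqP lp lq.
  have [/existsP[e /andP[eF se]]|no] := boolP [exists e in F, same_edge (gate e) (pt_val p) (pt_val q)].
    rewrite (xor_single eF) ?se /=.
      have /gateP[ga _] := subsetP sF e eF.
      move: se ga; rewrite /J => /orP[]/eqP-> /= ga; first by rewrite ga.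
      by rewrite gstepC ga /= jumpC // gstepC.
    move=> f fF; apply: contraNF => /andP[sf _].
    have [x [y [_ -> lx ly]]] := lab_same_edge eF se.
    have [x' [y' [_ -> lx' ly']]] := lab_same_edge fF sf.
    by move: lx' ly'; rewrite lx ly => -[->] [->].
  rewrite big1.
    rewrite /J; case: (boolP (gstep _ _)) => //= pq.
    rewrite /jump (face_unblocked pq) ?addbb // /blocked (negbTE no) orbF lp.
    by rewrite eq_sym (negbTE lq).
  by move=> e eF; apply/negbTE; apply: contra no => /andP[se _]; apply/existsP; exists e; rewrite eF.
have : \xor_(e in F) \xor_(p in S) \xor_(q in ~: S)
   (same_edge (gate e) (pt_val p) (pt_val q) && jump rho (gate e).1 (gate e).2) = false.
  rewrite -[RHS]cut [LHS]exchange_big /=; apply: eq_bigr => p pS.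
  rewrite [LHS]exchange_big /=; apply: eq_bigr => q qS; rewrite JE //.
  by rewrite in_setC in qS.
(* The gate of [e] leaves the set of [u] exactly once if [u] is an end of [e],
   and does not leave it otherwise. *)
have one e : e \in F -> \xor_(p in S) \xor_(q in ~: S)
      (same_edge (gate e) (pt_val p) (pt_val q) && jump rho (gate e).1 (gate e).2) =
    (u \in e) && jump rho (gate e).1 (gate e).2.
  move=> eF; have [ga [x [y [xy E lx ly]]]] := gateP (subsetP sF _ eF).
  have [px [qx [px_le qx_le]]] := gate_pts eF.
  have [ue|une] /= := boolP (u \in e); last first.
    apply: big1 => p; rewrite inE => /eqP lp; apply: big1 => q _.
    apply: contraNF une => /andP[/(lab_same_edge eF)[x' [y' [_ -> lx' _]]] _].
    by move: lp; rewrite lx' => -[->]; rewrite set21.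
  have [p0 [q0 [p0S q0S se]]] : exists p0 q0 : pt,
      [/\ p0 \in S, q0 \notin S & same_edge (gate e) (pt_val p0) (pt_val q0)].
    have : (u == x) || (u == y) by rewrite -in_set2 -E.
    case/orP=> /eqP Eu.
      exists px, qx; rewrite !inE px_le qx_le lx ly Eu eqxx; split=> //.
        by apply: contra xy => /eqP[->].
      by rewrite /same_edge -surjective_pairing eqxx.
    exists qx, px; rewrite !inE px_le qx_le lx ly Eu eqxx; split=> //.
    by rewrite /same_edge -surjective_pairing eqxx orbT.
  have uniq_edge (p q : pt) : p \in S -> q \notin S -> same_edge (gate e) (pt_val p) (pt_val q) ->
      p = p0 /\ q = q0.
    move=> pS qS; case/orP: se => /eqP-> /orP[]/eqP[].
    - by move=> /ord_inj e1 /ord_inj e2 /ord_inj e3 /ord_inj e4; split; apply/pair_eqP; rewrite /= ?e1 ?e2 ?e3 ?e4 /pair_eq !eqxx.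
    - move=> /ord_inj e1 /ord_inj e2 _ _.
      have Eq : p0 = q by apply/pair_eqP; rewrite /pair_eq e1 e2 !eqxx.
      by rewrite -Eq p0S in qS.
    - move=> /ord_inj e1 /ord_inj e2 _ _.
      have Eq : q0 = p by apply/pair_eqP; rewrite /pair_eq e1 e2 !eqxx.
      by rewrite Eq pS in q0S.
    - by move=> /ord_inj e1 /ord_inj e2 /ord_inj e3 /ord_inj e4; split; apply/pair_eqP; rewrite /= ?e1 ?e2 ?e3 ?e4 /pair_eq !eqxx.
  rewrite (xor_single p0S) => [|p pS pp0].
    rewrite (@xor_single _ _ _ q0) ?se ?in_setC //= => q; rewrite in_setC => qS qq0.
    by apply: contraNF qq0 => /andP[/(uniq_edge _ _ p0S qS)[_ ->]].
  apply: big1 => q; rewrite in_setC => qS.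
  by apply: contraNF pp0 => /andP[/(uniq_edge _ _ pS qS)[->]].
rewrite (eq_bigr _ one) => H; rewrite -[RHS]H (big_mkcond [in F]) [LHS]big_mkcond.
apply: eq_bigr => e _; rewrite inE.
by case: (e \in F) => //=; rewrite andbC; case: (jump _ _ _).
Qed.

Definition anchor p : point := if lab p is Some v then c v else p.

(** The parity of the ray crossings of a walk from center to center through
    the gate of [e].  The second route is traversed backwards, which does not
    matter for parities. *)
Definition winding (e : {set G}) (s : point) : bool :=
  let: (p, q) := gate e in
  walk_parity (cross s) (anchor p) (route p) (+)
  (cross s p q (+) walk_parity (cross s) (anchor q) (route q)).

Lemma route_avoids b p v : lab p = Some v -> ~~ ((lab b.1 == lab b.2) && (lab b.1 != None)) ->
  walk_parity (same_edge b) (c v) (route p) = false.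
Proof.
move=> lp nb; have [_ _ al] := routeP lp.
apply: (walk_parity0 _ al) => x y /eqP lx /eqP ly; apply: contraNF nb.
by case/orP=> /eqP->; rewrite /= lx ly eqxx.
Qed.

Lemma winding_sides e b : e \in F -> gstep b.1 b.2 ->
  ~~ ((lab b.1 == lab b.2) && (lab b.1 != None)) ->
  winding e (side1 b.1 b.2) (+) winding e (side2 b.1 b.2) =
  same_edge b (gate e).1 (gate e).2 (+) \xor_(u in e) ray_end b (c u).
Proof.
move=> eF gb nb; have := gateP (subsetP sF _ eF); rewrite /winding.
case: (gate e) => p q /= [ga [x [y [xy E lp lq]]]].
have [pp lastp _] := routeP lp; have [pq lastq _] := routeP lq.
rewrite /anchor lp lq E big_setU1 ?in_set1 //= big_set1.
rewrite addbACA (addbACA (cross _ _ _)) !cross_sides_walk // cross_sides //.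
rewrite (route_avoids lp nb) (route_avoids lq nb) lastp lastq !addFb.
move: (same_edge _ _ _) (ray_end b (c x)) (ray_end b (c y)) (ray_end b p) (ray_end b q).
by do 5 case.
Qed.

(** Around an even set the [ray_end] terms of the centers cancel, since every
    center is used an even number of times, and what remains is the number of
    traversals of [b] by gates, because routes stay inside the sets. *)
Lemma winding_jump (z : {set {set G}}) b : z \subset F -> even_set z -> gstep b.1 b.2 ->
  ~~ ((lab b.1 == lab b.2) && (lab b.1 != None)) ->
  (\xor_(e in z) winding e (side1 b.1 b.2)) (+) (\xor_(e in z) winding e (side2 b.1 b.2)) =
  \xor_(e in z) same_edge b (gate e).1 (gate e).2.
Proof.
move=> zF ez gb nb; rewrite -big_split /=.
rewrite (eq_bigr (fun e => same_edge b (gate e).1 (gate e).2 (+) \xor_(u in e) ray_end b (c u))); last first.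
  by move=> e /(subsetP zF) eF; exact: winding_sides.
rewrite big_split /= [X in _ (+) X](_ : _ = false) ?addbF //.
transitivity (\xor_(u | true) (ray_end b (c u) && \xor_(e in z) (u \in e))).
  under eq_bigr => e _ do rewrite big_mkcond.
  rewrite exchange_big /=; apply: eq_bigr => u _; case: (ray_end b (c u)) => /=.
    by apply: eq_bigr => e _; case: (u \in e).
  by apply: big1 => e _; case: (u \in e).
by apply: big1 => u _; rewrite ez andbF.
Qed.

Lemma to_sq_sides (p q : pt) :
  (sq_val (to_sq (side1 (pt_val p) (pt_val q))) = side1 (pt_val p) (pt_val q)) *
  (sq_val (to_sq (side2 (pt_val p) (pt_val q))) = side2 (pt_val p) (pt_val q)).
Proof.
case: p q => [p1 p2] [q1 q2].
have [h1 h2] := (ltn_ord p1, ltn_ord p2).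
have m1 : minn p1 q1 <= M by rewrite geq_min -ltnS h1.
have m2 : minn p2 q2 <= M by rewrite geq_min -ltnS h2.
by split; rewrite to_sqK // /side1 /side2 /=; case: eqP => _ /=; rewrite ?ltnS // ltnW.
Qed.

(** The parity of the crossings of the closed walks that trace [z]: it does
    not change across unblocked grid edges and changes across a gate exactly
    when the corresponding edge is in [z]. *)
Lemma face_winding (z : {set {set G}}) : z \subset F -> even_set z ->
  exists w : sq -> bool, forall e, e \in F ->
    (e \in z) = w (face (side1 (gate e).1 (gate e).2)) (+) w (face (side2 (gate e).1 (gate e).2)).
Proof.
move=> zF ez; pose w (s : sq) := \xor_(e in z) winding e (sq_val s); exists w.
have w1 s t : fadj1 s t -> w s = w t.
  move=> /existsP[p /existsP[q /and4P[pq nb /eqP-> /eqP->]]].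
  have nb' : ~~ ((lab (pt_val p) == lab (pt_val q)) && (lab (pt_val p) != None)).
    by apply: contra nb => h; rewrite /blocked h.
  have := @winding_jump z (pt_val p, pt_val q) zF ez pq nb'.
  rewrite [X in _ = X -> _]big1 => [|e eZ]; last first.
    apply: contraNF nb => se; apply/orP; right; apply/existsP; exists e.
    rewrite (subsetP zF) //=; move: se; rewrite /same_edge -surjective_pairing.
    by rewrite eq_sym; case: (gate e) => x y; rewrite [_ == (y, x)]eq_sym !xpair_eqE /= [(y == _) && _]andbC.
  by rewrite /w !to_sq_sides /=; do 2 case: (\xor_(e in z) _).
have wr s : w (fingraph.root fadj s) = w s.
  have /connectP[l] := connect_root fadj s; move: (fingraph.root fadj s) => t.
  elim: l s => [s _ -> //|t' l IH s /= /andP[st pl] El].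
  by rewrite (IH t') //; case/orP: st => /w1.
move=> e eF; have [ga [x [y [xy E lx ly]]]] := gateP (subsetP sF _ eF).
have [p [q [Ep Eq]]] := gate_pts eF.
have nb : ~~ ((lab (gate e).1 == lab (gate e).2) && (lab (gate e).1 != None)).
  by rewrite lx ly andbT; apply: contra xy => /eqP[->].
have := winding_jump zF ez ga nb.
rewrite /face !wr /w -Ep -Eq !to_sq_sides => ->.
have sameE f : f \in z -> same_edge (gate e) (gate f).1 (gate f).2 -> f = e.
  move=> fz /(lab_same_edge eF)[x' [y' [_ Ee lx' ly']]].
  have [_ [x2 [y2 [_ Ef lx2 ly2]]]] := gateP (subsetP sF _ (subsetP zF _ fz)).
  by rewrite Ee Ef; move: lx2 ly2; rewrite lx' ly' => -[->] [->].
have [ez'|ez'] := boolP (e \in z).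
  rewrite (xor_single ez') => [|f fz]; first by rewrite /same_edge -surjective_pairing eqxx.
  by apply: contraNF => /(sameE _ fz)->.
rewrite big1 // => f fz; apply: contraNF ez' => /(sameE _ fz) <-; exact: fz.
Qed.

End Gates.

Lemma grid_minor_bound k (V : {set G}) :
  (forall p : seq G, graph_cycle p -> k <= size p) ->
  (forall e, e \in F -> e \subset V) -> V != set0 ->
  k * #|F|.+1 <= 2 * #|F| + k * #|V|.
Proof.
move=> girth_k sV V0.
have [gate gateP] := boolp.choice edge_gate.
have [route routeP] := boolp.choice class_route.
apply: (@two_sided_bound _ _ (fun e => face gate (side1 (gate e).1 (gate e).2))
          (fun e => face gate (side2 (gate e).1 (gate e).2))) => //.
- exact: face_boundary_even gateP.
- exact: face_winding gateP routeP.
- by move=> z /subset_trans/(_ sF); exact: even_set_card.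
Qed.

End Minor.

(** * From grid walks to a grid minor *)
Definition near_pt (n : nat) (p q : nat * nat) : bool :=
  [&& p.1 <= q.1 + n, q.1 <= p.1 + n, p.2 <= q.2 + n & q.2 <= p.2 + n].

Lemma near_ptC n p q : near_pt n p q = near_pt n q p.
Proof. by rewrite /near_pt; lia. Qed.

Lemma near_pt_trans m n p q r : near_pt m p q -> near_pt n q r -> near_pt (m + n) p r.
Proof. by rewrite /near_pt; lia. Qed.

Lemma near_pt_le m n p q : m <= n -> near_pt m p q -> near_pt n p q.
Proof. by rewrite /near_pt; lia. Qed.

Lemma near_pt0 n p : near_pt n p p.
Proof. by rewrite /near_pt; lia. Qed.

Lemma near_pt1_pos p q : near_pt 1 p q -> (1 < p.1) && (1 < p.2) -> (0 < q.1) && (0 < q.2).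
Proof. by rewrite /near_pt; lia. Qed.

(** Step from [q] towards [p], which stays in the square around [p]. *)
Lemma square_walk n p q : near_pt n p q ->
  exists l, [/\ path gstep p l, last p l = q & all (near_pt n p) (p :: l)].
Proof.
have [d] := ubnP ((p.1 - q.1) + (q.1 - p.1) + ((p.2 - q.2) + (q.2 - p.2))).
elim: d q => // d IH q; rewrite ltnS => le_d pq.
have [->|ne] := eqVneq q p; first by exists [::]; rewrite /= near_pt0.
suff [q' [qq' lt_d pq']] : exists q', [/\ gstep q' q,
    (p.1 - q'.1) + (q'.1 - p.1) + ((p.2 - q'.2) + (q'.2 - p.2)) < d & near_pt n p q'].
  have [l [pl ll al]] := IH q' lt_d pq'; exists (rcons l q).
  rewrite rcons_path pl ll qq' last_rcons; split=> //.
  by rewrite -rcons_cons all_rcons pq al.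
case: p q ne le_d pq {IH} => p1 p2 [q1 q2]; rewrite xpair_eqE /near_pt /gstep /= => ne le_d pq.
have [lt|le1] := ltnP p1 q1; first by exists (q1.-1, q2); split=> /=; lia.
have [lt|ge1] := ltnP q1 p1; first by exists (q1.+1, q2); split=> /=; lia.
have [lt|le2] := ltnP p2 q2; first by exists (q1, q2.-1); split=> /=; lia.
have [lt|ge2] := ltnP q2 p2; first by exists (q1, q2.+1); split=> /=; lia.
lia.
Qed.

(** The set of a vertex [x] will consist of the square of radius [rad] around
    [c x] and, for each edge with source [x], the part of the walk of that edge
    that precedes its first visit to the square of the target. *)
Section MinorOfWalks.
Variables (G : sgraph) (rad : nat) (c : G -> nat * nat).
Variables (src dst : {set G} -> G) (steps : {set G} -> seq (nat * nat)).
Hypothesis srcP : forall e, e \in edges G -> e = [set src e; dst e].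
Hypothesis steps_path : forall e, e \in edges G -> path gstep (c (src e)) (steps e).
Hypothesis steps_last : forall e, e \in edges G -> last (c (src e)) (steps e) = c (dst e).
Notation walk e := (c (src e) :: steps e).
Hypothesis walks_cross : forall e f g, e \in edges G -> f \in edges G -> e != f ->
  g \in walk e -> g \in walk f -> exists x, near_pt rad (c x) g.
Hypothesis squares_disjoint : forall x y g, near_pt rad (c x) g -> near_pt rad (c y) g -> x = y.
Hypothesis walk_square : forall e g z, e \in edges G -> g \in walk e ->
  near_pt rad (c z) g -> z \in e.
Hypothesis squares_pos : forall x, (rad < (c x).1) && (rad < (c x).2).
Hypothesis walks_pos : forall e g, e \in edges G -> g \in walk e -> (0 < g.1) && (0 < g.2).

Lemma src_neq_dst e : e \in edges G -> src e != dst e.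
Proof. by move=> eE; have := card_edge eE; rewrite {1}(srcP eE) cards2; case: (_ != _). Qed.

Lemma edge_mem e z : e \in edges G -> z \in e -> z = src e \/ z = dst e.
Proof.
move=> eE ze; have : z \in [set src e; dst e] by rewrite -srcP.
by rewrite in_set2 => /orP[]/eqP->; [left|right].
Qed.

Definition pre (e : {set G}) : seq (nat * nat) :=
  c (src e) :: take (find (near_pt rad (c (dst e))) (steps e)) (steps e).

Lemma pre_walk e g : g \in pre e -> g \in walk e.
Proof. by rewrite !inE => /orP[->//|/mem_take->]; rewrite orbT. Qed.

(** A walk meets only the squares of its two ends, and [pre e] stops before
    the square of the target. *)
Lemma pre_square e g z : e \in edges G -> g \in pre e -> near_pt rad (c z) g -> z = src e.
Proof.
move=> eE gp zg; have [//|zen] := edge_mem eE (walk_square eE (pre_walk gp) zg).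
move: gp zg; rewrite zen inE => /orP[/eqP-> ng|].
  by apply: (squares_disjoint ng); exact: near_pt0.
move=> gp ng; have : index g (steps e) < find (near_pt rad (c (dst e))) (steps e).
  by rewrite index_ltn.
by move=> /(before_find (0, 0)); rewrite nth_index ?(mem_take gp) // ng.
Qed.

Lemma pre_next e : e \in edges G -> exists g,
  gstep (last (c (src e)) (behead (pre e))) g /\ near_pt rad (c (dst e)) g.
Proof.
move=> eE; set P := near_pt rad (c (dst e)).
have hasP : has P (steps e).
  apply/hasP; exists (c (dst e)); last exact: near_pt0.
  have := mem_last (c (src e)) (steps e); rewrite (steps_last eE) inE => /orP[/eqP ce|//].
  have same : near_pt rad (c (dst e)) (c (src e)) by rewrite ce near_pt0.
  by have := src_neq_dst eE; rewrite (squares_disjoint same (near_pt0 _ _)) eqxx.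
exists (nth (0, 0) (steps e) (find P (steps e))); split; last exact: nth_find.
have := steps_path eE; rewrite -{1}(cat_take_drop (find P (steps e)) (steps e)) cat_path => /andP[_].
by rewrite (drop_nth (0, 0)) -?has_find // => /andP[].
Qed.

(** Squares take precedence over walks, as several walks may run through the
    same square. *)
Definition lab (g : nat * nat) : option G :=
  if [pick x | near_pt rad (c x) g] is Some x then Some x
  else omap src [pick e in edges G | g \in pre e].

Lemma lab_square x g : near_pt rad (c x) g -> lab g = Some x.
Proof.
move=> xg; rewrite /lab; case: pickP => [y yg|/(_ x)]; last by rewrite xg.
by rewrite (squares_disjoint xg yg).
Qed.

Lemma lab_pre e g : e \in edges G -> g \in pre e -> lab g = Some (src e).
Proof.
move=> eE gp; rewrite /lab; case: pickP => [y yg|none]; first by rewrite (pre_square eE gp yg).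
case: pickP => [f /andP[fE gf]|/(_ e)]; last by rewrite eE gp.
rewrite /=; have [->//|fe] := eqVneq f e.
have [x xg] := walks_cross fE eE fe (pre_walk gf) (pre_walk gp).
by rewrite none in xg.
Qed.

Lemma labP g v : lab g = Some v ->
  near_pt rad (c v) g \/ exists e, [/\ e \in edges G, g \in pre e & src e = v].
Proof.
rewrite /lab; case: pickP => [y yg [<-]|_]; first by left.
by case: pickP => //= e /andP[eE gp] [<-]; right; exists e.
Qed.

Lemma minor_of_walks : exists lab' c' M, @grid_minor G lab' c' M.
Proof.
exists lab, c, (\sum_x ((c x).1 + (c x).2 + rad).+1 + \sum_e \sum_(g <- pre e) (g.1 + g.2).+1).
split.
- move=> g v /labP[vg|[e [eE gp _]]].
    rewrite (bigD1 v) //=; have := squares_pos v; move: vg; rewrite /near_pt; lia.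
  have := walks_pos eE (pre_walk gp); rewrite [X in _ + X](bigD1 e) //= (big_rem g gp) /=; lia.
- move=> g v /labP[vg|[e [eE gp <-]]].
    have [l [pl ll al]] := square_walk vg; exists l; split=> //.
    by apply/allP => q /(allP al)/lab_square->.
  have pp : path gstep (c (src e)) (behead (pre e)).
    by have := steps_path eE; rewrite -{1}(cat_take_drop (find (near_pt rad (c (dst e))) (steps e)) (steps e)) cat_path => /andP[].
  have al : all (fun q => lab q == Some (src e)) (pre e).
    by apply/allP => q /(lab_pre eE)->.
  move: gp; rewrite inE => /orP[/eqP->|gp].
    by exists [::]; split=> //=; move: al => /= /andP[-> _].
  move: pp al; rewrite /pre /=; case/path.splitP: gp => l1 l2.
  rewrite cat_path => /andP[pl _] /andP[l0]; rewrite all_cat => /andP[al _].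
  by exists (rcons l1 g); split; rewrite ?last_rcons //= l0.
- have key e : e \in edges G -> exists p q,
      [/\ gstep p q, lab p = Some (src e) & lab q = Some (dst e)].
    move=> eE; have [g [sg ng]] := pre_next eE.
    exists (last (c (src e)) (behead (pre e))), g; split=> //; last exact: lab_square.
    by apply: lab_pre => //; rewrite /pre /= mem_last.
  move=> x y xy; have eE : [set x; y] \in edges G by rewrite edge2.
  have [p [q [pq lp lq]]] := key _ eE.
  have xE : x \in [set x; y] by rewrite set21.
  have yE : y \in [set x; y] by rewrite set22.
  have := adj_neq xy.
  case: (edge_mem eE xE) => Ex; case: (edge_mem eE yE) => Ey.
  + by move=> /eqP; case; exact: etrans Ex (esym Ey).
  + by exists p, q; rewrite -Ex in lp; rewrite -Ey in lq.
  + by exists q, p; rewrite gstepC -Ex in lq *; rewrite -Ey in lp.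
  + by move=> /eqP; case; exact: etrans Ex (esym Ey).
Qed.

End MinorOfWalks.

From mathcomp Require Import all_classical all_reals all_analysis.

Import numFieldNormedType.Exports.

Local Open Scope classical_set_scope.
Local Open Scope ring_scope.

(** * Separation and rounding in the plane *)
Section Analysis.
Variable R : realType.
Implicit Types (p q : R * R).

Lemma compact_separation (K L : set (R * R)) :
  compact K -> compact L -> K `&` L = set0 ->
  exists2 d, 0 < d & forall p q, K p -> L q -> d <= `|p - q|.
Proof.
move=> cK cL KL.
have [[x Ax]|A0] := pselect (K `*` L !=set0); last first.
  by exists 1 => // p q Kp Lq; case: A0; exists (p, q).
have cf : {within K `*` L, continuous (fun x : (R * R) * (R * R) => `|x.1 - x.2|)}.
  apply: continuous_subspaceT => z; apply: cvg_norm; apply: cvgB.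
    exact: cvg_fst.
  exact: cvg_snd.
have [[p0 q0] /set_mem[/= Kp Lq] min0] :=
  compact_EVT_min (ex_intro _ x Ax) (compact_setX cK cL) cf.
exists `|p0 - q0|.
  rewrite normr_gt0 subr_eq0; apply/eqP => pq.
  have : (K `&` L) p0 by split=> //; rewrite pq.
  by rewrite KL.
by move=> p q Kp' Lq'; apply: (min0 (p, q)); apply/mem_set.
Qed.

Lemma uniform_pos (T : finType) (P : T -> R -> Prop) :
  (forall x d d', P x d -> 0 < d' -> d' <= d -> P x d') ->
  (forall x, exists2 d, 0 < d & P x d) ->
  exists2 d, 0 < d & forall x, P x d.
Proof.
move=> down ex.
have /choice[d dP] : forall x, exists d, 0 < d /\ P x d.
  by move=> x; have [d] := ex x; exists d.
have pos : 0 < \big[Num.min/1]_x d x.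
  by apply/bigmin_gtP; split=> // x _; have [] := dP x.
exists (\big[Num.min/1]_x d x) => // x; have [_ Px] := dP x; apply: (down _ _ _ Px) => //; exact: bigmin_le.
Qed.

Notation I01 := (`[0 : R, 1]%classic : set R).

(** A property that is locally constant on [0, 1] is constant, the segment
    being connected. *)
Lemma segment_ind (P : R -> Prop) : P 0 ->
  (forall t, I01 t -> exists2 d, 0 < d &
     forall s, I01 s -> `|s - t| < d -> P s <-> P t) ->
  P 1.
Proof.
move=> P0 loc.
have in0 : I01 0 by rewrite /= in_itv /= lexx ler01.
have in1 : I01 1 by rewrite /= in_itv /= lexx ler01.
pose B := I01 `&` P.
have key (Q : R -> Prop) : (forall t s, (P s <-> P t) -> (Q s <-> Q t)) ->
    I01 `&` Q = I01 `&` (interior [set s | I01 s -> Q s]).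
  move=> PQ; apply/seteqP; split=> t [t01].
    move=> Qt; split=> //.
    have [d d0 dP] := loc t t01; exists d => //= s; rewrite /ball_ /= distrC => st s01.
    by apply/(PQ t s) => //; exact: dP.
  by move=> /interior_subset /(_ t01).
suff EB : B = I01 by have [] : B 1 by rewrite EB.
apply: (@segment_connected R 0 1).
- by exists 0.
- exists (interior [set s | I01 s -> P s]); first exact: open_interior.
  by apply: key.
- exists (~` (interior [set s | I01 s -> ~ P s])).
    by apply: open_closedC; exact: open_interior.
  have E := key (fun s => ~ P s) (fun t s st => not_iff_compat st).
  apply/seteqP; split=> t [t01].
    move=> Pt; split=> // /interior_subset /(_ t01); exact.
  move=> nI; split=> //; apply: contrapT => nP.
  have : (I01 `&` (fun s => ~ P s)) t by [].
  by rewrite E => -[_ /nI].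
Qed.

Variables (N : R) (L : R) (k : nat).
Hypothesis N0 : 0 < N.

(** Scaling by [N] and truncating rounds to a grid of mesh [1 / N].  The shift
    [L] makes the coordinates nonnegative, where truncation is the floor, and
    the offset [k] leaves room for squares of radius less than [k]. *)
Definition round p : nat * nat :=
  ((k + Num.truncn (N * (p.1 + L)))%N, (k + Num.truncn (N * (p.2 + L)))%N).

Lemma round_ge p : (k <= (round p).1)%N && (k <= (round p).2)%N.
Proof. by rewrite !leq_addr. Qed.

Lemma truncn_le_add (a b : R) (n : nat) : 0 <= a -> 0 <= b -> a <= b + n%:R ->
  (Num.truncn a <= Num.truncn b + n)%N.
Proof.
move=> a0 b0 ab; rewrite truncn_le_nat (le_lt_trans ab) // -addSn natrD ltrD2r.
exact: truncnS_gt.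
Qed.

Lemma truncn_add_le (a b : R) (n : nat) : 0 <= a -> 0 <= b ->
  (Num.truncn a <= Num.truncn b + n)%N -> a <= b + n.+1%:R.
Proof.
move=> a0 b0; rewrite truncn_le_nat => /ltW /le_trans; apply.
by rewrite -addnS natrD lerD2r truncn_le.
Qed.

Definition in_box p := `|p| <= L.

Lemma in_boxP p : in_box p -> 0 <= N * (p.1 + L) /\ 0 <= N * (p.2 + L).
Proof.
rewrite /in_box prod_normE ge_max !ler_norml => /andP[/andP[h1 _] /andP[h2 _]].
by split; (apply: mulr_ge0; [exact: ltW | lra]).
Qed.

Lemma near_round n p q : in_box p -> in_box q -> N * `|p - q| <= n%:R ->
  near_pt n (round p) (round q).
Proof.
move=> /in_boxP[p1 p2] /in_boxP[q1 q2] pq.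
have h1 : `|N * (p.1 + L) - N * (q.1 + L)| <= n%:R.
  rewrite -mulrBr opprD addrACA subrr addr0 normrM gtr0_norm //; apply: le_trans pq.
  by rewrite ler_pM2l // prod_normE le_max lexx.
have h2 : `|N * (p.2 + L) - N * (q.2 + L)| <= n%:R.
  rewrite -mulrBr opprD addrACA subrr addr0 normrM gtr0_norm //; apply: le_trans pq.
  by rewrite ler_pM2l // prod_normE le_max lexx orbT.
move: h1 h2; rewrite !ler_norml => /andP[a b] /andP[c d].
by rewrite /near_pt /round /= -!addnA !leq_add2l !truncn_le_add //; lra.
Qed.

Lemma round_near n p q : in_box p -> in_box q -> near_pt n (round p) (round q) ->
  N * `|p - q| <= n.+1%:R.
Proof.
move=> /in_boxP[p1 p2] /in_boxP[q1 q2]; rewrite /near_pt /round /= -!addnA !leq_add2l.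
move=> /and4P[a b c d].
have normN (z : R) : N * `|z| = `|N * z| by rewrite normrM gtr0_norm.
rewrite prod_normE maxr_pMr ?(ltW N0) // ge_max !normN !mulrBr !ler_norml.
have := truncn_add_le p1 q1 a; have := truncn_add_le q1 p1 b.
have := truncn_add_le p2 q2 c; have := truncn_add_le q2 p2 d.
rewrite !mulrDr; move: n.+1%:R => m *.
by apply/andP; split; apply/andP; split; lra.
Qed.

(** Points of the arc at nearby parameters round to points of a common square
    of radius 1, inside which they can be joined; connectedness of the
    parameter segment then replaces uniform continuity. *)
Lemma arc_walk (f : R -> R * R) : {within I01, continuous f} ->
  (forall t, I01 t -> in_box (f t)) ->
  exists l, [/\ path gstep (round (f 0)) l, last (round (f 0)) l = round (f 1) &
    forall g, g \in round (f 0) :: l -> exists2 t, I01 t & near_pt 1 (round (f t)) g].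
Proof.
move=> /subspace_continuousP cf box.
pose P t := exists l, [/\ path gstep (round (f 0)) l, last (round (f 0)) l = round (f t) &
    forall g, g \in round (f 0) :: l -> exists2 t, I01 t & near_pt 1 (round (f t)) g].
have in0 : I01 0 by rewrite /= in_itv /= lexx ler01.
suff : P 1 by [].
have step s t : I01 s -> I01 t -> near_pt 1 (round (f s)) (round (f t)) -> P s -> P t.
  move=> s01 t01 st [l [pl ll al]].
  have [l' [pl' ll' al']] := square_walk st.
  exists (l ++ l'); rewrite cat_path last_cat pl ll pl' ll'; split=> // g.
  rewrite -cat_cons mem_cat => /orP[/al//|gl'].
  by exists s => //; rewrite (allP al') // inE gl' orbT.
apply: segment_ind.
  exists [::]; split=> // g; rewrite inE => /eqP->; exists 0 => //; exact: near_pt0.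
move=> t t01; have := cf t t01.
move/cvgrPdist_lt => /(_ N^-1); rewrite invr_gt0 => /(_ N0).
rewrite near_withinE => -[d /= d0 dP]; exists d => // s s01 st.
have nst : near_pt 1 (round (f t)) (round (f s)).
  apply: near_round; [exact: box|exact: box|].
  rewrite mulrC -ler_pdivlMr // mul1r ltW //; apply: (dP s) => //=.
  by rewrite distrC.
by split; apply: step => //; rewrite near_ptC.
Qed.

End Analysis.

(** * Drawings are grid minors *)
Section Drawing.
Variables (R : realType) (G : sgraph).
Variables (pos : G -> R * R) (arc : {set G} -> R -> R * R).
Hypothesis posI : injective pos.
Hypothesis arcP : forall e, e \in edges G ->
  [/\ {within `[0, 1], continuous (arc e)},
      {in `[0, 1] &, injective (arc e)} &
      [set arc e 0; arc e 1] = pos @` [set` e]].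
Hypothesis arc_pos : forall e, e \in edges G -> arc e @` `]0, 1[ `&` range pos = set0.
Hypothesis arc_arc : forall e f, e \in edges G -> f \in edges G -> e != f ->
  arc e @` `]0, 1[ `&` arc f @` `[0, 1] = set0.

Notation K e := (arc e @` `[0, 1]).

Lemma arc_ends e : e \in edges G ->
  exists d : G * G, [/\ e = [set d.1; d.2]%SET, pos d.1 = arc e 0 & pos d.2 = arc e 1].
Proof.
move=> eE; have [_ inj ends] := arcP eE.
have [u /= ue pu] : (pos @` [set` e]) (arc e 0) by rewrite -ends; left.
have [w /= we pw] : (pos @` [set` e]) (arc e 1) by rewrite -ends; right.
exists (u, w); split=> //=.
have uw : u != w.
  apply/eqP => uw; suff : 0 = 1 :> R by move/eqP; rewrite eq_sym oner_eq0.
  by apply: inj; rewrite ?in_itv /= ?lexx ?ler01 // -pu -pw uw.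
apply/eqP; rewrite eq_sym eqEcard (card_edge eE) cards2 uw andbT.
by apply/fintype.subsetP => z; rewrite in_set2 => /orP[]/eqP->.
Qed.

Lemma arc_cases e p : e \in edges G -> K e p ->
  (arc e @` `]0, 1[) p \/ exists2 x, x \in e & p = pos x.
Proof.
move=> eE [t]; rewrite /= in_itv /= => /andP[t0 t1] <-.
have [[u w] /= [E pu pw]] := arc_ends eE.
move: t0; rewrite le_eqVlt => /orP[/eqP<-|t0].
  by right; exists u; rewrite // E set21.
move: t1; rewrite le_eqVlt => /orP[/eqP->|t1].
  by right; exists w; rewrite // E set22.
by left; exists t; rewrite //= in_itv /= t0.
Qed.

Lemma compact_arc e : e \in edges G -> compact (K e).
Proof.
by move=> /arcP[ce _ _]; apply: continuous_compact => //; exact: segment_compact.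
Qed.

Lemma arc_avoids e z : e \in edges G -> z \notin e -> ~ K e (pos z).
Proof.
move=> eE ze /(arc_cases eE)[az|[x xe /posI zx]]; last by rewrite zx xe in ze.
suff : (arc e @` `]0, 1[ `&` range pos) (pos z) by rewrite arc_pos.
by split=> //; exists z.
Qed.

Lemma vertex_separation : exists2 d, 0 < d &
  forall x y, x != y -> d <= `|pos x - pos y|.
Proof.
have [||d d0 dP] := @uniform_pos R (G * G)%type
  (fun xy d => xy.1 != xy.2 -> d <= `|pos xy.1 - pos xy.2|).
- by move=> [x y] d d' /= H _ dd' /H; exact: le_trans.
- move=> [x y] /=; have [->|xy] := eqVneq x y; first by exists 1.
  exists `|pos x - pos y| => //; rewrite normr_gt0 subr_eq0.
  by apply: contra xy => /eqP/posI->.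
by exists d => // x y; apply: (dP (x, y)).
Qed.

Lemma arc_vertex_separation : exists2 d, 0 < d &
  forall e z p, e \in edges G -> z \notin e -> K e p -> d <= `|p - pos z|.
Proof.
have [||d d0 dP] := @uniform_pos R ({set G} * G)%type
  (fun ez d => ez.1 \in edges G -> ez.2 \notin ez.1 ->
     forall p, K ez.1 p -> d <= `|p - pos ez.2|).
- by move=> [e z] d d' /= H _ dd' eE ze p Kp; apply: le_trans dd' _; exact: H.
- move=> [e z] /=; have [/andP[eE ze]|] := boolP ((e \in edges G) && (z \notin e)); last first.
    by move=> nez; exists 1 => // eE ze; rewrite eE ze in nez.
  have [||d d0 dP] := @compact_separation R (K e) [set pos z] (compact_arc eE).
  + exact: compact_set1.
  + by apply/seteqP; split=> // p [Kp /= pz]; apply: (arc_avoids eE ze); rewrite -pz.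
  by exists d => // _ _ p Kp; exact: dP.
by exists d => // e z p eE ze; apply: (dP (e, z)).
Qed.

Lemma drawing_bounded : exists2 L : R, (forall e p, e \in edges G -> K e p -> `|p| <= L) &
  forall x, `|pos x| <= L.
Proof.
have [||d d0 dP] := @uniform_pos R {set G}
  (fun e d => e \in edges G -> forall p, K e p -> `|p| <= d^-1).
- move=> e d d' /= H d'0 dd' eE p Kp; apply: le_trans (H eE p Kp) _.
  by rewrite lef_pV2 ?posrE // (lt_le_trans d'0).
- move=> e; have [eE|] := boolP (e \in edges G); last by exists 1.
  have [M [_ HM]] := compact_bounded (compact_arc eE).
  have M0 : 0 < `|M| + 1 by rewrite ltr_wpDl.
  exists (`|M| + 1)^-1; first by rewrite invr_gt0.
  move=> _ p Kp; rewrite invrK; apply: (HM (`|M| + 1)) => //.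
  by rewrite ltr_pwDr // ler_norm.
exists (d^-1 + \sum_x `|pos x|) => [e p eE Kp|x].
  by rewrite (le_trans (dP e eE p Kp)) // lerDl sumr_ge0.
rewrite (bigD1 x) //= addrCA lerDl; apply: addr_ge0; last exact: sumr_ge0.
by rewrite invr_ge0 ltW.
Qed.

(** Off the open balls of radius [r] around its ends, the arc of [e] is compact
    and disjoint from the arc of [f]. *)
Lemma arc_separation r : 0 < r -> exists2 d, 0 < d &
  forall e f p q, e \in edges G -> f \in edges G -> e != f -> K e p -> K f q ->
    `|p - q| < d -> exists2 x, x \in e & `|p - pos x| < r.
Proof.
move=> r0.
have [||d d0 dP] := @uniform_pos R ({set G} * {set G})%type
  (fun ef d => ef.1 \in edges G -> ef.2 \in edges G -> ef.1 != ef.2 ->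
     forall p q, K ef.1 p -> K ef.2 q ->
    `|p - q| < d -> exists2 x, x \in ef.1 & `|p - pos x| < r).
- move=> [e f] d d' /= H _ dd' eE fE ef p q Kp Kq pq.
  by apply: (H eE fE ef p q) => //; exact: lt_le_trans dd'.
- move=> [e f] /=.
  have [/and3P[eE fE ef]|] := boolP [&& e \in edges G, f \in edges G & e != f]; last first.
    by move=> n; exists 1 => // eE fE ef; rewrite eE fE ef in n.
  pose far := \bigcap_(x in [set` e]) [set p | r <= `|p - pos x|].
  have cfar : closed far.
    apply: closed_bigI => x _.
    have -> : [set p | r <= `|p - pos x|] = (fun p => `|p - pos x|) @^-1` [set z | r <= z] by [].
    apply: (closed_comp _ (@closed_ge R r)) => p _.
    by apply: cvg_norm; apply: cvgB; [exact: cvg_id | exact: cvg_cst].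
  have [|||d d0 dP] := @compact_separation R (K e `&` far) (K f).
  + by apply: compact_closedI => //; exact: compact_arc.
  + exact: compact_arc.
  + apply/seteqP; split=> // p [[Kp farp] Kfp].
    have [ap|[x xe px]] := arc_cases eE Kp.
      by rewrite -(arc_arc eE fE ef).
    by have := farp x xe; rewrite /= px subrr normr0 leNgt r0.
  exists d => // _ _ _ p q Kp Kq pq.
  apply: contrapT => nex.
  suff /dP/(_ Kq) : (K e `&` far) p by rewrite leNgt pq.
  split=> // x /= xe; rewrite leNgt; apply/negP => px; apply: nex; by exists x.
by exists d => // e f p q eE fE ef; apply: (dP (e, f)).
Qed.

(** Take for [r] a quarter of the least distance between two vertices or
    between a vertex and an arc not ending there, and for [h] the distance
    under which two arcs are within [r] of a common vertex.  The mesh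
    [1 / N] must be small compared to both [h] and [r]; the grid radius [n]
    exceeds [N * r] by just enough to absorb the rounding errors. *)
Lemma drawing_grid_minor : exists lab c M, @grid_minor G lab c M.
Proof.
have [d1 d1_gt0 d1P] := vertex_separation.
have [d2 d2_gt0 d2P] := arc_vertex_separation.
have [L LK Lpos] := drawing_bounded.
pose r := Num.min d1 d2 / 4.
have r0 : 0 < r by rewrite divr_gt0 // lt_min d1_gt0.
have rd1 : 4 * r <= d1 by rewrite /r mulrCA divff // mulr1 ge_min lexx.
have rd2 : 4 * r <= d2 by rewrite /r mulrCA divff // mulr1 ge_min lexx orbT.
have [h h0 hP] := arc_separation r0.
pose N := 4 / h + 8 / r.
have N0 : 0 < N by rewrite addr_gt0 // divr_gt0.
(* Points at grid distance 2 are at distance at most 3 in units of the mesh. *)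
have Nh : 3 < N * h.
  have : 0 < 8 / r * h by rewrite mulr_gt0 // divr_gt0.
  have -> : N * h = 4 + 8 / r * h by rewrite (mulrDl (4 / h)) divfK // gt_eqF.
  lra.
have Nr : 8 <= N * r.
  have : 0 < 4 / h * r by rewrite mulr_gt0 // divr_gt0.
  have -> : N * r = 4 / h * r + 8 by rewrite (mulrDl (4 / h)) (divfK (x := r)) // gt_eqF.
  lra.
have [m Nrm mNr] : exists2 m : nat, N * r <= m%:R & m%:R <= N * r + 1.
  exists (Num.truncn (N * r)).+1; first by rewrite ltW // truncnS_gt.
  by rewrite -natr1 lerD2r truncn_le mulr_ge0 // ltW.
(* A walk point is within 1 of a rounded arc point, hence within [m + 1] of a
   vertex whenever the arc point is within [r] of it. *)
pose n := m.+2.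
have nE : n%:R = m%:R + 2 :> R by rewrite /n -[m.+2]addn2 natrD.
(* The offset keeps squares of radius [n], and walks within 1 of rounded
   points, at positive coordinates. *)
pose rd := round N L n.+2.
have boxK e p : e \in edges G -> K e p -> in_box L p by exact: LK.
have /choice[ends endsP] : forall e, exists d : G * G, e \in edges G ->
    [/\ e = [set d.1; d.2]%SET, pos d.1 = arc e 0 & pos d.2 = arc e 1].
  move=> e; have [/arc_ends[d dE]|] := boolP (e \in edges G); first by exists d.
  have [x _] : exists x : G, x \in G by apply/card_gt0P; exact: vertex_gt0.
  by exists (x, x).
have /choice[A AP] : forall e, exists l : seq (nat * nat), e \in edges G ->
    [/\ path gstep (rd (arc e 0)) l, last (rd (arc e 0)) l = rd (arc e 1) &
     forall g, g \in rd (arc e 0) :: l -> exists2 p, K e p & near_pt 1 (rd p) g].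
  move=> e; have [eE|] := boolP (e \in edges G); last by exists [::].
  have [ce _ _] := arcP eE.
  have [|l [pl ll al]] := @arc_walk R N L n.+2 N0 (arc e) ce.
    by move=> t t01; apply: (boxK e) => //; exists t.
  exists l => _; split=> // g /al[t t01 tg]; exists (arc e t) => //; by exists t.
apply: (@minor_of_walks G n (rd \o pos) (fun e => (ends e).1) (fun e => (ends e).2) A).
- by move=> e /endsP[].
- by move=> e eE /=; have [_ -> _] := endsP e eE; have [] := AP e eE.
- by move=> e eE /=; have [_ -> ->] := endsP e eE; have [] := AP e eE.
- move=> e f g eE fE ef /=.
  have [_ -> _] := endsP e eE; have [_ -> _] := endsP f fE.
  have [_ _ Ae] := AP e eE; have [_ _ Af] := AP f fE.
  move=> /Ae[p Kp pg] /Af[q Kq qg].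
  have pq : near_pt 2 (rd p) (rd q) by apply: (near_pt_trans (m := 1) (n := 1) pg); rewrite near_ptC.
  have := round_near N0 (boxK _ _ eE Kp) (boxK _ _ fE Kq) pq => pq3.
  have [|x xe px] := hP e f p q eE fE ef Kp Kq.
    by rewrite -(ltr_pM2l N0); apply: le_lt_trans pq3 Nh.
  exists x; suff : near_pt (m + 1) (rd (pos x)) g.
    by apply: near_pt_le; rewrite addn1 leqW.
  apply: near_pt_trans pg; rewrite near_ptC; apply: near_round => //; [exact: boxK Kp|exact: Lpos|].
  by apply: le_trans Nrm; rewrite ler_pM2l // ltW.
- move=> x y g /= xg yg; apply/eqP; apply: contraT => xy.
  have xy' : near_pt (n + n) (rd (pos x)) (rd (pos y)).
    by apply: near_pt_trans xg _; rewrite near_ptC.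
  have := round_near N0 (Lpos x) (Lpos y) xy'.
  have : N * (4 * r) <= N * `|pos x - pos y|.
    by rewrite ler_pM2l // (le_trans rd1) // d1P.
  rewrite -[(n + n).+1%:R]natr1 natrD nE; lra.
- move=> e g z eE /=; have [_ -> _] := endsP e eE; have [_ _ Ae] := AP e eE.
  move=> /Ae[p Kp pg] zg; apply: contraT => ze.
  have pz : near_pt (1 + n) (rd p) (rd (pos z)).
    by apply: near_pt_trans pg _; rewrite near_ptC.
  have := round_near N0 (boxK _ _ eE Kp) (Lpos z) pz.
  have : N * (4 * r) <= N * `|p - pos z|.
    by rewrite ler_pM2l // (le_trans rd2) // (d2P e).
  rewrite -[(1 + n).+1%:R]natr1 natrD nE; lra.
- move=> x /=; have /andP[x1 x2] := round_ge N L n.+2 (pos x).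
  by rewrite (ltnW x1) (ltnW x2).
- move=> e g eE /=; have [_ -> _] := endsP e eE; have [_ _ Ae] := AP e eE.
  move=> /Ae[p _ pg]; have /andP[p1 p2] := round_ge N L n.+2 p.
  by apply: near_pt1_pos pg _; rewrite (leq_trans _ p1) ?(leq_trans _ p2).
Qed.

End Drawing.

Lemma planar_grid_minor (R : realType) (G : sgraph) : planar G R ->
  exists lab c M, @grid_minor G lab c M.
Proof. case=> pos [arc [posI arcP arc_pos arc_arc]].
exact: (drawing_grid_minor posI arcP arc_pos arc_arc). Qed.

(** * Planar graphs of large girth *)
Lemma girth_cycle (R : realType) (G : sgraph) k : (k%:R%:E <= girth G R)%E ->
  forall p : seq G, graph_cycle p -> (k <= size p)%N.
Proof.
move=> kG p cp; rewrite -(ler_nat R) -lee_fin; apply: le_trans kG _.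
by apply: ereal_inf_lbound; exists p.
Qed.

Lemma planar_girth_mad (R : realType) (G : sgraph) : planar G R -> (7%:E <= girth G R)%E ->
  mad G < 20 / 7.
Proof.
move=> /planar_grid_minor[lab [c [M minor]]] /girth_cycle girth7.
have q0 : 0 < 20 / 7 :> rat by rewrite divr_gt0 ?ltr0n.
apply: (mad_lt q0) => V F V0 sF sV.
have := grid_minor_bound minor sF girth7 sV V0 => bound.
have lt : (2 * #|F| * 7 < 20 * #|V|)%N by clear -bound; lia.
rewrite mulrAC ltr_pdivlMr; last by rewrite ltr0n.
by rewrite -!natrM ltr_nat.
Qed.

Theorem theorem2 :
  (forall G : sgraph, mad G < 20 / 7 -> (chi_o G <= 5)%N) /\
  (forall (R : realType) (G : sgraph),
     planar G R -> (7%:E <= girth G R)%E ->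
     mad G < 20 / 7 /\ (chi_o G <= 5)%N).
Proof.
have mad_chi (G : sgraph) : mad G < 20 / 7 -> (chi_o G <= 5)%N.
  by move=> /sparse_of_mad/chi_o_le5.
split=> [G|R G pl gi]; first exact: mad_chi.
by have madG := planar_girth_mad pl gi; split; [|exact: mad_chi].
Qed.
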